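(* Let $a\in(0,1)$ and let $P(z) = (z-a)\prod_{j=1}^{n-1}(z-z_j)$ be a polynomial of degree $n$ that contradicts Sendov's conjecture at $a$. Put $\gamma(a) = 0.1a+0.9$, $c = a\gamma(a)$, $p' = \frac{a/4}{1-a/2}$, $q' = \frac{a/4}{1+a/2}$, $$r = \frac{c(a-c)}{2(1-c^2)},\qquad \alpha = \frac{\log ( a/16 )}{\log \left( \frac{c+r}{1+cr} \right)},$$ $$K' = \min \left\{ (1+c-ac)^{p'} \left(\sqrt{1+c^2-ac}\right)^{1-p'},\ (1+c)^{q'} \left(\sqrt{1+c^2-ac}\right)^{1-q'} \right\}.$$ Let $\mathcal{N}_0(a) = \frac{32 \log ( 40/a^2 )}{a^2}$ and $\mathcal{N}_1(a) = \max \left \{ 9 \left( \frac{4+2a}{a} \right)^2 , \mathcal{N}_0(a) \right \}$. If $n \geq \mathcal{N}_1(a)$, then $$|P(c)|\geq \frac{(1-c)(a-c)}{1-ac}\, r^\alpha\, {K'}^{\,n-1}.$$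
   Context: A polynomial $P(z) = (z-a)\prod_{j=1}^{n-1}(z-z_j)$ with $a\in(0,1)$ and $|z_j|\le 1$ for all $j$ is said to contradict Sendov's conjecture at $a$ if every zero $w$ of $P'$ satisfies $|w-a|>1$. *)

(* Defs.v *)
From Stdlib Require Import Reals List.
Open Scope R_scope.

Definition Cx := (R * R)%type.
Definition RtoC (x : R) : Cx := (x, 0).
Definition Cadd (z w : Cx) : Cx := (fst z + fst w, snd z + snd w).
Definition Copp (z : Cx) : Cx := (- fst z, - snd z).
Definition Csub (z w : Cx) : Cx := Cadd z (Copp w).
Definition Cmul (z w : Cx) : Cx :=
  (fst z * fst w - snd z * snd w, fst z * snd w + snd z * fst w).
Definition C0 : Cx := (0, 0).
Definition C1 : Cx := (1, 0).
Definition Cmod (z : Cx) : R := sqrt (fst z ^ 2 + snd z ^ 2).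

(* polynomials: coefficient lists, constant term first *)
Definition poly := list Cx.

Fixpoint padd (p q : poly) : poly :=
  match p, q with
  | nil, _ => q
  | _, nil => p
  | x :: p', y :: q' => Cadd x y :: padd p' q'
  end.

Definition pscale (c : Cx) (p : poly) : poly := map (Cmul c) p.

Definition pmul_lin (r : Cx) (p : poly) : poly :=
  padd (C0 :: p) (pscale (Copp r) p).

Fixpoint poly_of_roots (rs : list Cx) : poly :=
  match rs with
  | nil => C1 :: nil
  | r :: rs' => pmul_lin r (poly_of_roots rs')
  end.

Fixpoint peval (p : poly) (z : Cx) : Cx :=
  match p with
  | nil => C0
  | c :: p' => Cadd c (Cmul z (peval p' z))
  end.

Fixpoint pderiv_aux (k : nat) (p : poly) : poly :=
  match p with
  | nil => nil
  | c :: p' => Cmul (RtoC (INR k)) c :: pderiv_aux (S k) p'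
  end.
Definition pderiv (p : poly) : poly :=
  match p with
  | nil => nil
  | _ :: p' => pderiv_aux 1 p'
  end.

Definition sendovP (a : R) (zs : list Cx) : poly := poly_of_roots (RtoC a :: zs).

Definition contradicts_sendov (a : R) (zs : list Cx) : Prop :=
  forall w : Cx, peval (pderiv (sendovP a zs)) w = C0 -> Cmod (Csub w (RtoC a)) > 1.

Definition gam (a : R) : R := 0.1 * a + 0.9.
Definition cc (a : R) : R := a * gam a.
Definition pp (a : R) : R := (a / 4) / (1 - a / 2).
Definition qq (a : R) : R := (a / 4) / (1 + a / 2).
Definition rr (a : R) : R := cc a * (a - cc a) / (2 * (1 - cc a ^ 2)).
Definition alpha (a : R) : R :=
  ln (a / 16) / ln ((cc a + rr a) / (1 + cc a * rr a)).
Definition Kp (a : R) : R :=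
  let c := cc a in
  Rmin (Rpower (1 + c - a * c) (pp a) * Rpower (sqrt (1 + c ^ 2 - a * c)) (1 - pp a))
       (Rpower (1 + c) (qq a) * Rpower (sqrt (1 + c ^ 2 - a * c)) (1 - qq a)).
Definition N0 (a : R) : R := 32 * ln (40 / a ^ 2) / a ^ 2.
Definition N1 (a : R) : R := Rmax (9 * ((4 + 2 * a) / a) ^ 2) (N0 a).

(* Main.v *)
(** Write [w_j] for the zeros of [P'] and [N = n - 1]. By Gauss-Lucas and the hypothesis they
    lie in the lune [|w| <= 1 < |w - a|], hence in [Re w < a / 2].

    The reflected product satisfies [c^n |P(1/c)| >= (1 - c) prod |1 - c w_j|], because
    [|P' / P| <= n / (1/c - 1)] at [1/c]; hence
    [|P(c)| >= (1 - c) (a - c) / (1 - a c) * prod (|c - z_j| / |1 - c z_j|) * prod |1 - c w_j|].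

    On the lune [ln |1 - c w|] is bounded below by the chords of a concave function of [Re w]
    through [-1], [a - 1] and [a / 2], so the last product is at least [K'^N] once the mean of
    [Re w_j] is at most [a / 4]. The first product is at least [r^alpha] once
    [prod |z_j| >= a / 16] and no [z_j] lies in the pseudo-hyperbolic disk of radius [r]
    around [c]: the points of that disk are closer than [a] to the whole lune, and by
    Grace's theorem [P] cannot take the same value at two points when all critical points lie
    strictly on one side of their bisector.

    The mean of [Re w_j] and [prod |z_j|] are controlled by [|P(2a/5)|] and [|P(0)|].
    Since [|P'(t)|] decays exponentially as [t] moves from [a] towards 0, Laplace's method on
    [P(t) = - int_t^a P'] gives a lower bound for these values in terms of [|P'(a)| >= n]. *)

Require Import Defs.
From Stdlib Require Import Reals List Lra Lia Psatz.
From mathcomp Require all_boot all_order all_algebra complex Rstruct.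
From Coquelicot Require Coquelicot.
Open Scope R_scope.

(** * Polynomials as products over lists of roots *)

Module RootLists.
Import Coquelicot.Coquelicot.
Local Open Scope C_scope.

Fixpoint croots (rs : list C) (x : C) : C :=
  match rs with
  | nil => 1
  | r :: rs' => (x - r) * croots rs' x
  end.

Fixpoint croots_deriv (rs : list C) (x : C) : C :=
  match rs with
  | nil => 0
  | r :: rs' => croots rs' x + (x - r) * croots_deriv rs' x
  end.

Fixpoint csum (f : C -> C) (rs : list C) : C :=
  match rs with
  | nil => 0
  | r :: rs' => f r + csum f rs'
  end.

Fixpoint rsum (f : C -> R) (rs : list C) : R :=
  match rs with
  | nil => 0%R
  | r :: rs' => (f r + rsum f rs')%R
  end.

Fixpoint rprod (f : C -> R) (rs : list C) : R :=
  match rs with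
  | nil => 1%R
  | r :: rs' => (f r * rprod f rs')%R
  end.

(* Convertible to [peval], but typed so that [ring] applies. *)
Fixpoint ceval (p : list C) (x : C) : C :=
  match p with
  | nil => 0
  | c :: p' => c + x * ceval p' x
  end.
End RootLists.

(** * Factorization of the derivative over the algebraically closed field [R[i]] *)

Module Factorization.
Import mathcomp.boot.all_boot mathcomp.order.all_order mathcomp.algebra.all_algebra.
Import mathcomp.real_closed.complex mathcomp.reals_stdlib.Rstruct.
Import GRing.Theory Num.Theory.
Local Open Scope ring_scope.

Local Notation R := Rdefinitions.R.
Local Notation C := Complex.C.

Definition toRi (z : C) : R[i] := (fst z +i* snd z)%C.
Definition ofRi (z : R[i]) : C := (complex.Re z, complex.Im z).

Lemma toRiK : cancel toRi ofRi. Proof. by case. Qed.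
Lemma ofRiK : cancel ofRi toRi. Proof. by case. Qed.

Lemma toRiD x y : toRi (Complex.Cplus x y) = toRi x + toRi y. Proof. by []. Qed.
Lemma toRiB x y : toRi (Complex.Cminus x y) = toRi x - toRi y. Proof. by []. Qed.
Lemma toRiM x y : toRi (Complex.Cmult x y) = toRi x * toRi y.
Proof.
case: x => x1 x2; case: y => y1 y2; rewrite /toRi /=.
by [].
Qed.

Lemma toRi_nat n : toRi (Complex.RtoC (INR n)) = n%:R.
Proof.
by rewrite INRE; apply/eqP; rewrite eq_complex /= raddfMn /= raddfMn /= mul0rn !eqxx.
Qed.

Lemma toRi_croots rs x :
  toRi (RootLists.croots rs x) = (\prod_(r <- map toRi rs) ('X - r%:P)).[toRi x].
Proof.
elim: rs => [|r rs IH] /=; first by rewrite big_nil hornerE.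
by rewrite big_cons hornerM !hornerE toRiM toRiB IH.
Qed.

Lemma toRi_croots_deriv rs x :
  toRi (RootLists.croots_deriv rs x) =
  ((\prod_(r <- map toRi rs) ('X - r%:P))^`()).[toRi x].
Proof.
elim: rs => [|r rs IH] /=; first by rewrite big_nil derivC horner0.
rewrite big_cons derivM derivXsubC mul1r !hornerE toRiD toRiM toRiB IH.
by rewrite toRi_croots.
Qed.

Lemma toRi_csum rs :
  toRi (RootLists.csum (fun z => z) rs) = \sum_(r <- map toRi rs) r.
Proof.
elim: rs => [|r rs IH] /=; first by rewrite big_nil.
by rewrite big_cons toRiD IH.
Qed.

Lemma map_ofRiK s : map toRi (map ofRi s) = s.
Proof. by rewrite -map_comp (eq_map (g := id)) ?map_id // => y; rewrite /= ofRiK. Qed.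

(** The roots [ws] exist because [R[i]] is algebraically closed, and the constant is the leading
    coefficient of the derivative. The last relation, equality of the two means when [ws] is
    nonempty, compares second coefficients: for n roots, differentiation multiplies the coefficient
    of X^(n-1) by n - 1. *)
Lemma croots_deriv_factor (rs : list C) : rs <> nil ->
  exists ws : list C,
    [/\ S (length ws) = length rs,
        forall x, RootLists.croots_deriv rs x =
          Complex.Cmult (Complex.RtoC (INR (length rs))) (RootLists.croots ws x)
      & Complex.Cmult (Complex.RtoC (INR (length ws))) (RootLists.csum (fun z => z) rs) =
        Complex.Cmult (Complex.RtoC (INR (length rs))) (RootLists.csum (fun z => z) ws)].
Proof.
move=> rs_neq0.
pose q := \prod_(r <- map toRi rs) ('X - r%:P).
have sz_rs : (0 < size rs)%N by case: rs rs_neq0 {q}.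
have szq : size q = (size rs).+1 by rewrite size_prod_XsubC size_map.
have cn : q`_(size rs) = 1.
  by have /monicP := monic_prod_XsubC (map toRi rs) xpredT id; rewrite lead_coefE szq.
have n0 : (size rs)%:R != 0 :> R[i] by rewrite pnatr_eq0 -lt0n.
have szq' : size q^`() = size rs.
  apply/eqP; rewrite eqn_leq; apply/andP; split.
    by have := lt_size_deriv (_ : q != 0); rewrite szq ltnS; apply; rewrite -size_poly_gt0 szq.
  rewrite leqNgt; apply/negP => lt.
  have := nth_default 0 (_ : size q^`() <= (size rs).-1)%N; rewrite -ltnS prednK // => /(_ lt).
  by rewrite coef_deriv prednK // cn => /eqP; rewrite (negbTE n0).
have lq : lead_coef q^`() = (size rs)%:R.
  by rewrite lead_coefE szq' coef_deriv prednK // cn.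
have [s Hs] := closed_field_poly_normal q^`().
have szs : size s = (size rs).-1.
  have := szq'; rewrite Hs size_scale ?lead_coef_eq0 -?size_poly_gt0 ?szq' //.
  by rewrite size_prod_XsubC => <-.
exists (map ofRi s); split.
- by rewrite -[length _]/(size _) size_map szs prednK.
- move=> x; apply: (can_inj toRiK).
  rewrite toRi_croots_deriv toRiM toRi_nat toRi_croots map_ofRiK -hornerZ.
  by rewrite -[length rs]/(size rs) -lq -Hs.
- apply: (can_inj toRiK); rewrite !toRiM !toRi_nat !toRi_csum map_ofRiK.
  rewrite -[length rs]/(size rs) -[length _]/(size _) size_map szs.
  (* With a single root, [ws] is empty and both sides are 0. *)
  case E : (size rs) sz_rs => [//|[|m]] _ /=.
    by rewrite (_ : s = [::]) ?big_nil ?mul0r ?mulr0 //; apply: size0nil; rewrite szs E.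
  have H1 : (q^`())`_m = - ((\sum_(r <- map toRi rs) r) * m.+1%:R).
    have := @coefPn_prod_XsubC _ (map toRi rs); rewrite size_map E /= => /(_ isT) Hq.
    by rewrite coef_deriv Hq -mulNr mulr_natr.
  have H2 : (q^`())`_m = - (m.+2%:R * \sum_(r <- s) r).
    have := @coefPn_prod_XsubC _ s; rewrite szs E /= => /(_ isT) Hq.
    by rewrite Hs coefZ lq E Hq mulrN.
  by apply: oppr_inj; rewrite -H2 H1 mulrC.
Qed.

End Factorization.

(** * Evaluation of coefficient lists; products and sums over lists of roots *)

Module RootBounds.
Import Coquelicot.Coquelicot RootLists.
Local Open Scope C_scope.

Lemma ceval_padd (p q : list C) (x : C) : ceval (padd p q) x = ceval p x + ceval q x.
Proof.
  revert q; induction p as [|c p IH]; intros q.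
  - change (ceval q x = 0 + ceval q x). ring.
  - destruct q as [|d q].
    + change (ceval (c :: p) x = ceval (c :: p) x + 0). ring.
    + change ((c + d) + x * ceval (padd p q) x = (c + x * ceval p x) + (d + x * ceval q x)).
      rewrite IH. ring.
Qed.

Lemma ceval_pscale (k : C) (p : list C) (x : C) : ceval (pscale k p) x = k * ceval p x.
Proof.
  induction p as [|c p IH].
  - change ((0 : C) = k * 0). ring.
  - change (k * c + x * ceval (pscale k p) x = k * (c + x * ceval p x)).
    rewrite IH. ring.
Qed.

Lemma ceval_poly_of_roots (rs : list C) (x : C) : ceval (poly_of_roots rs) x = croots rs x.
Proof.
  induction rs as [|r rs IH].
  - change (1 + x * 0 = 1). ring.
  - unfold poly_of_roots; fold poly_of_roots. unfold pmul_lin.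
    rewrite ceval_padd, ceval_pscale.
    change ((0 + x * ceval (poly_of_roots rs) x) + (- r) * ceval (poly_of_roots rs) x
            = (x - r) * croots rs x).
    rewrite IH. ring.
Qed.

(** Raising the starting exponent by one counts each coefficient once more; this is the product rule
    for X p behind [ceval_pderiv_cons]. *)
Lemma ceval_pderiv_aux_S (k : nat) (p : list C) (x : C) :
  ceval (pderiv_aux (S k) p) x = ceval (pderiv_aux k p) x + ceval p x.
Proof.
  revert k; induction p as [|c p IH]; intros k.
  - change ((0 : C) = 0 + 0). ring.
  - change (RtoC (INR (S k)) * c + x * ceval (pderiv_aux (S (S k)) p) x =
            (RtoC (INR k) * c + x * ceval (pderiv_aux (S k) p) x) + (c + x * ceval p x)).
    rewrite (IH (S k)), S_INR, RtoC_plus. ring.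
Qed.

Lemma ceval_pderiv_cons (c : C) (p : list C) (x : C) :
  ceval (pderiv (c :: p)) x = ceval p x + x * ceval (pderiv p) x.
Proof.
  destruct p as [|d p].
  - change ((0 : C) = 0 + x * 0). ring.
  - change (RtoC (INR 1) * d + x * ceval (pderiv_aux 2 p) x =
            (d + x * ceval p x) + x * ceval (pderiv_aux 1 p) x).
    rewrite ceval_pderiv_aux_S. simpl INR. ring.
Qed.

Lemma ceval_pderiv_padd (p q : list C) (x : C) :
  ceval (pderiv (padd p q)) x = ceval (pderiv p) x + ceval (pderiv q) x.
Proof.
  revert q; induction p as [|c p IH]; intros q.
  - change (ceval (pderiv q) x = 0 + ceval (pderiv q) x). ring.
  - destruct q as [|d q].
    + change (ceval (pderiv (c :: p)) x = ceval (pderiv (c :: p)) x + 0). ring.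
    + change (padd (c :: p) (d :: q)) with (Cadd c d :: padd p q).
      rewrite !ceval_pderiv_cons, IH, ceval_padd. ring.
Qed.

Lemma ceval_pderiv_pscale (k : C) (p : list C) (x : C) :
  ceval (pderiv (pscale k p)) x = k * ceval (pderiv p) x.
Proof.
  induction p as [|c p IH].
  - change ((0 : C) = k * 0). ring.
  - change (pscale k (c :: p)) with (Cmul k c :: pscale k p).
    rewrite !ceval_pderiv_cons, IH, ceval_pscale. ring.
Qed.

Lemma ceval_pderiv_poly_of_roots (rs : list C) (x : C) :
  ceval (pderiv (poly_of_roots rs)) x = croots_deriv rs x.
Proof.
  induction rs as [|r rs IH].
  - reflexivity.
  - unfold poly_of_roots; fold poly_of_roots. unfold pmul_lin.
    rewrite ceval_pderiv_padd, ceval_pderiv_pscale, ceval_pderiv_cons, IH, ceval_poly_of_roots.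
    change (Defs.Copp r) with (- r). simpl. ring.
Qed.

Lemma Cmod_croots (rs : list C) (x : C) :
  Cmod (croots rs x) = rprod (fun r => Cmod (x - r)) rs.
Proof.
  induction rs as [|r rs IH]; simpl.
  - apply Cmod_1.
  - now rewrite Cmod_mult, IH.
Qed.

Lemma croots_eq0 (rs : list C) (r : C) : In r rs -> croots rs r = 0.
Proof.
  induction rs as [|r' rs IH]; simpl; [easy|].
  intros [->|H]; [|rewrite IH by easy]; ring.
Qed.

Lemma Cmult_eq0_r (x y : C) : x <> 0 -> x * y = 0 -> y = 0.
Proof.
  intros Hx H. replace y with (/ x * (x * y)) by (field; exact Hx). rewrite H. ring.
Qed.

Lemma croots_neq0 (rs : list C) (x : C) :
  (forall r, In r rs -> x - r <> 0) -> croots rs x <> 0.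
Proof.
  induction rs as [|r rs IH]; simpl; intros H.
  - apply C1_nz.
  - apply Cmult_neq_0; auto.
Qed.

Lemma croots_deriv_log (rs : list C) (x : C) :
  (forall r, In r rs -> x - r <> 0) ->
  croots_deriv rs x = croots rs x * csum (fun r => / (x - r)) rs.
Proof.
  induction rs as [|r rs IH]; simpl; intros H.
  - ring.
  - rewrite IH by auto. field. auto.
Qed.

Lemma rprod_le (f g : C -> R) (rs : list C) :
  (forall r, In r rs -> 0 <= f r <= g r)%R -> (0 <= rprod f rs <= rprod g rs)%R.
Proof.
  induction rs as [|r rs IH]; simpl; intros H.
  - lra.
  - destruct (H r (or_introl eq_refl)).
    destruct (IH (fun s Hs => H s (or_intror Hs))).
    split; [now apply Rmult_le_pos|now apply Rmult_le_compat].
Qed.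

Lemma rprod_pos (f : C -> R) (rs : list C) :
  (forall r, In r rs -> 0 < f r)%R -> (0 < rprod f rs)%R.
Proof.
  induction rs as [|r rs IH]; simpl; intros H.
  - lra.
  - apply Rmult_lt_0_compat; auto.
Qed.

Lemma rprod_mult (f g : C -> R) (rs : list C) :
  rprod (fun r => f r * g r)%R rs = (rprod f rs * rprod g rs)%R.
Proof. induction rs as [|r rs IH]; simpl; [ring|rewrite IH; ring]. Qed.

Lemma rprod_ext (f g : C -> R) (rs : list C) :
  (forall r, In r rs -> f r = g r) -> rprod f rs = rprod g rs.
Proof.
  induction rs as [|r rs IH]; simpl; intros H; [easy|].
  rewrite H, IH; auto.
Qed.

Lemma rprod_const (k : R) (rs : list C) : rprod (fun _ => k) rs = (k ^ length rs)%R.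
Proof. induction rs as [|r rs IH]; simpl; [easy|now rewrite IH]. Qed.

Lemma ln_rprod (f : C -> R) (rs : list C) :
  (forall r, In r rs -> 0 < f r)%R -> ln (rprod f rs) = rsum (fun r => ln (f r)) rs.
Proof.
  induction rs as [|r rs IH]; simpl; intros H.
  - apply ln_1.
  - rewrite ln_mult, IH; auto. apply rprod_pos; auto.
Qed.

Lemma rsum_le (f g : C -> R) (rs : list C) :
  (forall r, In r rs -> f r <= g r)%R -> (rsum f rs <= rsum g rs)%R.
Proof.
  induction rs as [|r rs IH]; simpl; intros H; [lra|].
  apply Rplus_le_compat; auto.
Qed.

Lemma rsum_scal (k : R) (f : C -> R) (rs : list C) :
  rsum (fun r => k * f r)%R rs = (k * rsum f rs)%R.
Proof. induction rs as [|r rs IH]; simpl; [ring|rewrite IH; ring]. Qed.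

Lemma rsum_affine (k l : R) (f : C -> R) (rs : list C) :
  rsum (fun r => k + l * f r)%R rs = (INR (length rs) * k + l * rsum f rs)%R.
Proof.
  induction rs as [|r rs IH].
  - simpl; ring.
  - change (length (r :: rs)) with (S (length rs)).
    rewrite S_INR; simpl rsum; rewrite IH; ring.
Qed.

Lemma rsum_const (k : R) (rs : list C) : rsum (fun _ => k) rs = (INR (length rs) * k)%R.
Proof.
  induction rs as [|r rs IH]; [simpl; ring|].
  change (length (r :: rs)) with (S (length rs)).
  rewrite S_INR; simpl rsum; rewrite IH; ring.
Qed.

Lemma Cmod_csum (f : C -> C) (rs : list C) :
  (Cmod (csum f rs) <= rsum (fun r => Cmod (f r)) rs)%R.
Proof.
  induction rs as [|r rs IH]; simpl.
  - rewrite Cmod_0; lra.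
  - eapply Rle_trans; [apply Cmod_triangle|lra].
Qed.

Lemma Re_csum (f : C -> C) (rs : list C) : Re (csum f rs) = rsum (fun r => Re (f r)) rs.
Proof.
  induction rs as [|r rs IH]; [easy|].
  change (Re (f r) + Re (csum f rs) = Re (f r) + rsum (fun r => Re (f r)) rs)%R.
  now rewrite IH.
Qed.

(** * Moduli, the Gauss-Lucas theorem and Laguerre's theorem *)

Lemma Cmod_sqr (z : C) : (Cmod z * Cmod z = fst z * fst z + snd z * snd z)%R.
Proof.
  unfold Cmod. rewrite sqrt_sqrt; [ring|]. nra.
Qed.

Lemma Cmod_le_iff (z : C) (k : R) :
  (0 <= k -> (Cmod z <= k <-> fst z * fst z + snd z * snd z <= k * k))%R.
Proof.
  intros Hk. rewrite <- Cmod_sqr. pose proof (Cmod_ge_0 z). split; intros; nra.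
Qed.

Lemma Re_le_Cmod (z : C) : (Re z <= Cmod z)%R.
Proof. pose proof (re_le_Cmod z). pose proof (Rle_abs (Re z)). lra. Qed.

Lemma Cmod_minus_sym (x y : C) : Cmod (x - y) = Cmod (y - x).
Proof. rewrite <- Cmod_opp. f_equal. ring. Qed.

Lemma Cmod_minus_ge (x y : C) : (Cmod x - Cmod y <= Cmod (x - y))%R.
Proof.
  pose proof (Cmod_triangle (x - y) y) as H.
  replace (x - y + y) with x in H by ring. lra.
Qed.

Lemma Re_mult_inv (w z : C) :
  Re (w * / z) = ((fst w * fst z + snd w * snd z) / (Cmod z * Cmod z))%R.
Proof.
  rewrite Cmod_sqr. destruct w as [w1 w2], z as [x y].
  unfold Re, Cmult, Cinv, fst, snd, Rdiv.
  replace (x ^ 2 + y ^ 2)%R with (x * x + y * y)%R by ring. ring.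
Qed.

Lemma Re_inv (z : C) : Re (/ z) = (Re z / (Cmod z * Cmod z))%R.
Proof.
  rewrite <- (Cmult_1_l (/ z)), Re_mult_inv. unfold Re. simpl. f_equal. ring.
Qed.

(* [Re (w / (w - z)) >= 1 / 2] as soon as [|z| <= |w|]. *)
Lemma critical_point_in_unit_disk (rs : list C) (w : C) :
  rs <> nil -> (forall r, In r rs -> Cmod r <= 1)%R -> croots_deriv rs w = 0 ->
  (Cmod w <= 1)%R.
Proof.
  intros Hne Hr Hw. apply Rnot_lt_le; intros Hgt.
  assert (Hnz : forall r, In r rs -> w - r <> 0).
  { intros r Hin E. specialize (Hr r Hin).
    replace w with r in Hgt; [lra|]. symmetry. rewrite <- (Cplus_0_l r), <- E. ring. }
  rewrite croots_deriv_log in Hw by easy.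
  assert (Hs : csum (fun r => / (w - r)) rs = 0).
  { apply (Cmult_eq0_r (croots rs w)); [now apply croots_neq0|easy]. }
  assert (H : (/ 2 * INR (length rs) <= Re (w * csum (fun r => / (w - r)) rs)%C)%R).
  { clear Hs Hw Hne. induction rs as [|r rs IH].
    - simpl. lra.
    - change (length (r :: rs)) with (S (length rs)). rewrite S_INR. simpl csum.
      rewrite Cmult_plus_distr_l.
      assert (Hr' : (Cmod r <= 1)%R) by (apply Hr; now left).
      assert (Hd : (0 < Cmod (w - r))%R) by (apply Cmod_gt_0, Hnz; now left).
      specialize (IH (fun s Hs => Hr s (or_intror Hs)) (fun s Hs => Hnz s (or_intror Hs))).
      assert (Hh : (/ 2 <= Re (w * / (w - r))%C)%R).
      { pose proof (Cmod_sqr (w - r)) as E.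
        rewrite Re_mult_inv. apply Rle_div_r; [nra|].
        rewrite E. pose proof (Cmod_sqr w) as Ew. pose proof (Cmod_sqr r) as Er.
        pose proof (Cmod_ge_0 r).
        assert (Cmod r * Cmod r <= Cmod w * Cmod w)%R by nra.
        destruct w as [w1 w2], r as [r1 r2]. simpl in *. nra. }
      change (/ 2 * (INR (length rs) + 1) <=
        Re (w * / (w - r))%C + Re (w * csum (fun s => / (w - s)) rs)%C)%R. lra. }
  rewrite Hs in H. replace (Re (w * 0)) with 0%R in H by (simpl; ring).
  destruct rs as [|r rs]; [easy|].
  change (length (r :: rs)) with (S (length rs)) in H. rewrite S_INR in H.
  pose proof (pos_INR (length rs)). lra.
Qed.

Lemma Cmod_croots_deriv_le (rs : list C) (x : C) :
  (1 < Cmod x)%R -> (forall r, In r rs -> Cmod r <= 1)%R ->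
  (Cmod (croots_deriv rs x) <= INR (length rs) / (Cmod x - 1) * Cmod (croots rs x))%R.
Proof.
  intros Hx Hr.
  assert (Hd : forall r, In r rs -> (Cmod x - 1 <= Cmod (x - r))%R).
  { intros r Hin. pose proof (Cmod_minus_ge x r). specialize (Hr r Hin). lra. }
  assert (Hnz : forall r, In r rs -> x - r <> 0).
  { intros r Hin. apply Cmod_gt_0. specialize (Hd r Hin). lra. }
  rewrite croots_deriv_log by easy. rewrite Cmod_mult, Rmult_comm.
  apply Rmult_le_compat_r; [apply Cmod_ge_0|].
  eapply Rle_trans; [apply Cmod_csum|].
  unfold Rdiv. rewrite <- rsum_const. apply rsum_le. intros r Hin.
  rewrite Cmod_inv by auto. apply Rinv_le_contravar; [lra|auto].
Qed.

(* [u = 1 / (zeta - z)] ranges over the disk [Re u >= rho |u|^2] with [rho = - Re z]; the mean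
   of the [u]'s, which the hypothesis makes equal to [1 / (w - z)], lies in it too. *)
Lemma laguerre (zs : list C) (w z : C) :
  zs <> nil -> (forall r, In r zs -> 0 <= fst r)%R -> (fst w < 0)%R ->
  RtoC (INR (length zs)) * croots zs z = (z - w) * croots_deriv zs z ->
  (0 <= fst z)%R.
Proof.
  intros Hne Hr Hw Hz. apply Rnot_lt_le; intros Hneg.
  assert (Hd : forall r, In r zs -> (0 < fst r - fst z)%R)
    by (intros r Hin; specialize (Hr r Hin); lra).
  assert (Hnz : forall r, In r zs -> z - r <> 0).
  { intros r Hin E. specialize (Hd r Hin). apply (f_equal fst) in E. simpl in E. lra. }
  rewrite croots_deriv_log in Hz by easy.
  assert (Hm : (0 < INR (length zs))%R).
  { destruct zs; [easy|]. simpl length. apply lt_0_INR. lia. }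
  assert (E : RtoC (INR (length zs)) = (z - w) * csum (fun r => / (z - r)) zs).
  { replace ((z - w) * csum (fun r => / (z - r)) zs) with
      (/ croots zs z * ((z - w) * (croots zs z * csum (fun r => / (z - r)) zs)))
      by (field; now apply croots_neq0).
    rewrite <- Hz. field. now apply croots_neq0. }
  assert (Hzw : w - z <> 0).
  { intros E0. replace (z - w) with (- (w - z)) in E by ring. rewrite E0 in E.
    replace (- (0) * csum (fun r => / (z - r)) zs) with (RtoC 0) in E by ring.
    apply RtoC_inj in E. lra. }
  set (iv := fun r : C => / (z - r)) in *.
  remember (/ (w - z)) as v eqn:Hv0.
  assert (Hsum : csum iv zs = - (RtoC (INR (length zs)) * v)).
  { rewrite E, Hv0. field. exact Hzw. }
  (* The disk condition is quadratic in u = [iv r]. Replacing |u|^2 by its tangent at the mean -v,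
     that is, using -Re z |u + v|^2 >= 0, makes it affine in u, so that it can be summed. *)
  assert (H : forall r, In r zs ->
    (0 <= (- fst z * (fst v * fst v + snd v * snd v)) +
      (-1) * (fst (iv r) + 2 * fst z * (fst (iv r) * fst v + snd (iv r) * snd v)))%R).
  { intros r Hin. specialize (Hr r Hin). specialize (Hd r Hin). specialize (Hnz r Hin).
    assert (Eu2 : ((fst (iv r) * fst (iv r) + snd (iv r) * snd (iv r)) *
       (fst r - fst z) = - fst (iv r))%R).
    { clear - Hd. unfold iv. destruct z as [z1 z2], r as [r1 r2]. simpl in *. field. intros E0.
      assert (0 < (r1 - z1) * (r1 - z1))%R by (apply Rmult_lt_0_compat; lra).
      pose proof (Rle_0_sqr (z2 - r2)) as Hq; unfold Rsqr in Hq. nra. }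
    remember (iv r) as u eqn:Eiv; clear Eiv.
    assert (0 <= - fst z * (Rsqr (fst u + fst v) + Rsqr (snd u + snd v)))%R.
    { apply Rmult_le_pos; [lra|]. apply Rplus_le_le_0_compat; apply Rle_0_sqr. }
    assert (0 <= fst r * (Rsqr (fst u) + Rsqr (snd u)))%R.
    { apply Rmult_le_pos; [lra|]. apply Rplus_le_le_0_compat; apply Rle_0_sqr. }
    unfold Rsqr in *. lra. }
  assert (Hs : (0 <= INR (length zs) * (- fst z * (fst v * fst v + snd v * snd v)) +
    (-1) * (fst (csum iv zs) + 2 * fst z *
      (fst (csum iv zs) * fst v + snd (csum iv zs) * snd v)))%R).
  { clear - H. clearbody iv. generalize dependent v. intros v H. induction zs as [|r zs IH].
    - simpl. lra.
    - specialize (IH (fun s Hs => H s (or_intror Hs))).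
      specialize (H r (or_introl eq_refl)).
      change (length (r :: zs)) with (S (length zs)). rewrite S_INR. simpl csum.
      remember (csum iv zs) as s eqn:Es; clear Es.
      remember (iv r) as u eqn:Eiv; clear Eiv.  simpl. lra. }
  rewrite Hsum in Hs. simpl in Hs.
  (* After division by the number of zeros, [Ev] turns this into Re w |v|^2 >= 0, against Re w <
     0. *)
  assert (Hv : (0 <= fst v + fst z * (fst v * fst v + snd v * snd v))%R).
  { apply (Rmult_le_reg_l (INR (length zs))); [easy|].  lra. }
  assert (Ev : (fst v = (fst w - fst z) * (fst v * fst v + snd v * snd v))%R).
  { clear - Hzw Hv0. subst v. destruct z as [z1 z2], w as [w1 w2]. simpl in *. field.
    intros E0. apply Hzw. apply Cmod_eq_0. unfold Cmod. simpl.
    transitivity (sqrt 0); [f_equal|apply sqrt_0]. etransitivity; [|exact E0]. ring. }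
  assert (Hpos : (0 < fst v * fst v + snd v * snd v)%R).
  { rewrite <- Cmod_sqr.
    assert (0 < Cmod v)%R.
    { rewrite Hv0, Cmod_inv by easy. apply Rinv_0_lt_compat. now apply Cmod_gt_0. }
    now apply Rmult_lt_0_compat. }
  assert (0 < - fst w * (fst v * fst v + snd v * snd v))%R
    by (apply Rmult_lt_0_compat; lra).
  lra.
Qed.

Lemma pow_S_lt (x y : R) (n : nat) : (0 <= x < y -> x ^ S n < y ^ S n)%R.
Proof.
  intros [Hx Hxy]. induction n as [|n IH]; [simpl; lra|].
  change (x * x ^ S n < y * y ^ S n)%R.
  apply Rmult_le_0_lt_compat; trivial. now apply pow_le.
Qed.

(** Equal powers have equal moduli, so z is equidistant from -1 and 1. This locates the zeros of (X
    + 1)^(n+1) - (X - 1)^(n+1). *)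
Lemma Cpow_eq_imaginary (n : nat) (z : C) :
  Cpow (z + 1) (S n) = Cpow (z - 1) (S n) -> fst z = 0%R.
Proof.
  intros E. apply (f_equal Cmod) in E. rewrite !Cmod_pow in E.
  assert (E' : Cmod (z + 1) = Cmod (z - 1)).
  { destruct (Rtotal_order (Cmod (z + 1)) (Cmod (z - 1))) as [H|[H|H]]; trivial; exfalso.
    - pose proof (pow_S_lt _ _ n (conj (Cmod_ge_0 _) H)). lra.
    - pose proof (pow_S_lt _ _ n (conj (Cmod_ge_0 _) H)). lra. }
  apply (f_equal (fun x => x * x)%R) in E'. rewrite !Cmod_sqr in E'.
  destruct z as [x y]. simpl in *. lra.
Qed.
End RootBounds.

(** * Grace's theorem by iterated polar derivatives *)

Module Grace.
Import mathcomp.boot.all_boot mathcomp.order.all_order mathcomp.algebra.all_algebra.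
Import mathcomp.real_closed.complex mathcomp.reals_stdlib.Rstruct.
Import GRing.Theory Num.Theory.
Import Factorization.
Local Open Scope ring_scope.

Local Notation Ri := (complex Rdefinitions.R).
Local Notation C := Complex.C.

Definition right (z : Ri) : Prop := Rle (IZR Z0) (fst (ofRi z)).
Definition left (z : Ri) : Prop := Rlt (fst (ofRi z)) (IZR Z0).

(** Laguerre's polar derivative with pole [w], for [g] of formal degree [m]. *)
Definition polar (m : nat) (w : Ri) (g : {poly Ri}) : {poly Ri} :=
  m%:R *: g - ('X - w%:P) * g^`().

(* The apolar pairing of [g] with the polynomial whose roots are [ws], as iterated polar
   derivatives; by Laguerre each of them keeps the zeros of [g] in the right half-plane. *)
Fixpoint polars (ws : seq Ri) (g : {poly Ri}) : Ri :=
  if ws is w :: ws' then polars ws' (polar (size ws) w g) else g`_0.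

Lemma polarD m w g h : polar m w (g + h) = polar m w g + polar m w h.
Proof. by rewrite /polar derivD mulrDr scalerDr opprD addrACA. Qed.

Lemma polarZ m w k g : polar m w (k *: g) = k *: polar m w g.
Proof. by rewrite /polar derivZ scalerBr -scalerAr !scalerA mulrC. Qed.

Lemma polarsD ws g h : polars ws (g + h) = polars ws g + polars ws h.
Proof. by elim: ws g h => [|w ws IH] g h /=; rewrite ?coefD ?polarD. Qed.

Lemma polarsZ ws k g : polars ws (k *: g) = k * polars ws g.
Proof. by elim: ws g => [|w ws IH] g /=; rewrite ?coefZ ?polarZ. Qed.

Lemma polarsB ws g h : polars ws (g - h) = polars ws g - polars ws h.
Proof. by rewrite -scaleN1r polarsD polarsZ mulN1r. Qed.

Lemma polars_sum ws n (F : 'I_n -> {poly Ri}) :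
  polars ws (\sum_i F i) = \sum_i polars ws (F i).
Proof.
apply: (big_morph (polars ws)); first exact: polarsD.
by rewrite -(scale0r 0) polarsZ mul0r.
Qed.

(** The polar derivative with pole w sends (X - x)^m to m (w - x) (X - x)^(m-1). Pairing with powers
    thus recovers, up to constants, the polynomial with roots [ws]. *)
Lemma polars_exp ws x :
  polars ws (('X - x%:P) ^+ size ws) = (size ws)`!%:R * \prod_(w <- ws) (w - x).
Proof.
elim: ws => [|w ws IH]; first by rewrite /= big_nil expr0 coefC mulr1.
rewrite /= big_cons; have -> : polar (size ws).+1 w (('X - x%:P) ^+ (size ws).+1) =
    ((size ws).+1%:R * (w - x)) *: ('X - x%:P) ^+ size ws.
  rewrite /polar deriv_exp derivXsubC mul1r /= exprS scaler_nat mulrnAr -mulrnBl -mulrBl.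
  rewrite -scalerA scaler_nat -mul_polyC polyCB; congr (_ * _ *+ _).
  by rewrite opprB addrC addrA subrK.
by rewrite polarsZ IH factS natrM mulrACA.
Qed.

Lemma rightD x y : right x -> right y -> right (x + y).
Proof.
by case: x => x1 x2; case: y => y1 y2; rewrite /right /=; apply: Rplus_le_le_0_compat.
Qed.

Lemma right_sum s : (forall z, z \in s -> right z) -> right (\sum_(z <- s) z).
Proof.
elim: s => [|z s IH] H; first by rewrite big_nil; exact: Rle_refl.
rewrite big_cons; apply: rightD; first by apply: H; rewrite mem_head.
by apply: IH => y Hy; apply: H; rewrite inE Hy orbT.
Qed.

Lemma in_map_ofRi s r : List.In r (map ofRi s) -> toRi r \in s.
Proof.
elim: s => [//|y s IH] /= [<-|/IH H]; first by rewrite ofRiK mem_head.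
by rewrite inE H orbT.
Qed.

Lemma polar_roots_right s w z :
  (0 < size s)%N -> (forall y, y \in s -> right y) -> left w ->
  root (polar (size s) w (\prod_(y <- s) ('X - y%:P))) z -> right z.
Proof.
move=> s0 Hs Hw /rootP; rewrite /polar !hornerE => Hz.
apply: (RootBounds.laguerre (map ofRi s) (ofRi w)); rewrite ?ofRiK.
- by case: s s0 {Hs Hz}.
- move=> r /in_map_ofRi /Hs; by rewrite /right toRiK.
- exact: Hw.
- apply: (can_inj toRiK); rewrite !toRiM toRiB toRi_nat toRi_croots toRi_croots_deriv.
  rewrite map_ofRiK !ofRiK -[length _]/(size _) size_map.
  by apply/eqP; rewrite -subr_eq0; apply/eqP.
Qed.

Lemma left_scaled_neq_right (m : nat) w z :
  (0 < m)%N -> left w -> right z -> m%:R * w != z.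
Proof.
move=> m0 Hw Hz; apply/eqP => E; move: Hz; rewrite -E /right -toRi_nat -[w]ofRiK -toRiM toRiK.
move: Hw; rewrite /left; case: (ofRi w) => w1 w2 /= Hw.
have Hm : Rlt (IZR Z0) (INR m) by apply: lt_0_INR; apply/ltP.
move: Hm Hw; generalize (INR m) => M Hm Hw; nra.
Qed.

(** The coefficient of degree m is (m + 1) w minus the sum of the roots; it cannot vanish, since the
    first term has negative real part and the sum a nonnegative one. The degree thus drops by
    exactly one. *)
Lemma size_polar m s w :
  size s = m.+1 -> (forall y, y \in s -> right y) -> left w ->
  size (polar m.+1 w (\prod_(y <- s) ('X - y%:P))) = m.+1.
Proof.
move=> Es Hs Hw; set g := \prod_(y <- s) _.
have szg : size g = m.+2 by rewrite size_prod_XsubC Es.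
have cg i : (polar m.+1 w g)`_i = g`_i *+ m.+1 - g`_i *+ i + w * (g`_i.+1 *+ i.+1).
  rewrite /polar coefB coefZ mulrBl coefB coefXM coefCM coef_deriv opprB addrA addrAC mulr_natl.
  by case: i => [|i] /=; rewrite ?mulr0n ?coef_deriv.
have g1 : g`_m.+1 = 1.
  by have /monicP := monic_prod_XsubC s xpredT id; rewrite lead_coefE szg.
have gm : g`_m = - \sum_(y <- s) y.
  by have := @coefPn_prod_XsubC _ s; rewrite Es /= => /(_ isT).
apply/eqP; rewrite eqn_leq; apply/andP; split.
  apply/leq_sizeP => i; rewrite leq_eqVlt => /orP[/eqP <-|lt].
    by rewrite cg subrr add0r [g`_m.+2]nth_default ?szg // mul0rn mulr0.
  by rewrite cg !nth_default ?szg ?mul0rn ?subr0 ?mulr0 ?addr0 // ltnW.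
rewrite ltnNge; apply/negP => /leq_sizeP/(_ m (leqnn _)); rewrite cg g1 gm.
rewrite -mulrnBr // subSnn mulr1n addrC mulrC => /eqP; rewrite subr_eq0.
by apply/negP/left_scaled_neq_right => //; apply: right_sum.
Qed.

(** Grace's apolarity theorem. Each polar derivative lowers the degree by exactly one and keeps the
    zeros on the right, so the last one is a nonzero constant. *)
Lemma polars_neq0 ws s k :
  k != 0 -> size s = size ws ->
  (forall w, w \in ws -> left w) -> (forall z, z \in s -> right z) ->
  polars ws (k *: \prod_(z <- s) ('X - z%:P)) != 0.
Proof.
elim: ws s k => [|w ws IH] s k k0 /= Es Hw Hs.
  by rewrite (size0nil Es) big_nil coefZ coefC mulr1.
have Hw0 : left w by apply: Hw; rewrite mem_head.
rewrite polarZ polarsZ mulf_neq0 //.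
set h := polar _ _ _; have szh : size h = (size ws).+1 by apply: size_polar.
have [s' Hs'] := closed_field_poly_normal h.
have lh : lead_coef h != 0 by rewrite lead_coef_eq0 -size_poly_gt0 szh.
rewrite Hs'; apply: IH => //.
- by have := szh; rewrite Hs' size_scale // size_prod_XsubC => -[].
- by move=> y Hy; apply: Hw; rewrite inE Hy orbT.
- move=> z Hz; apply: (@polar_roots_right s w) => //; rewrite Es // -/h Hs'.
  by rewrite rootZ // root_prod_XsubC.
Qed.

Lemma toRiX z n : toRi (Complex.Cpow z n) = toRi z ^+ n.
Proof. by elim: n => [|n IH] //=; rewrite toRiM IH exprS. Qed.

Lemma expr_eq_right n (z : Ri) : (z + 1) ^+ n.+1 = (z - 1) ^+ n.+1 -> right z.
Proof.
move=> E; apply: Req_le_sym; apply: (RootBounds.Cpow_eq_imaginary n).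
by apply: (can_inj toRiK); rewrite !toRiX toRiD toRiB ofRiK.
Qed.

Lemma deriv_eq0 (p : {poly Ri}) : p^`() = 0 -> p = (p`_0)%:P.
Proof.
move=> H; apply/polyP => -[|i]; rewrite coefC //=.
have := coef_deriv p i; rewrite H coef0 => /esym/eqP.
by rewrite mulrn_eq0 => /eqP.
Qed.

(** [1 - p] takes only the value 1, so it has no root and is constant. *)
Lemma horner_eq0 (p : {poly Ri}) : (forall x, p.[x] = 0) -> p = 0.
Proof.
move=> H; have [|/closed_rootP[x /rootP]] := eqVneq (size (1 - p)) 1%N.
  move=> /eqP/size_poly1P[c _ E].
  have pE : p = (1 - c)%:P by rewrite polyCB -E opprB addrC subrK.
  by have := H 0; rewrite pE hornerC => ->.
by rewrite !hornerE H subr0 => /eqP; rewrite oner_eq0.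
Qed.

(** By [polars_exp], the derivative of q at x is a multiple of the pairing with (X - x)^N.
    Integrating over x from -1 to 1 inside the pairing replaces this power by a multiple of (X +
    1)^(N+1) - (X - 1)^(N+1). *)
Lemma symmetric_increment ws (q : {poly Ri}) k :
  q^`() = k *: \prod_(w <- ws) ('X - w%:P) ->
  exists2 l, l != 0 &
    l * (q.[1] - q.[-1]) =
    k * polars ws (('X + 1) ^+ (size ws).+1 - ('X - 1) ^+ (size ws).+1).
Proof.
set N := size ws => Hq.
pose nu j := polars ws 'X^j.
(* The antiderivative in x, vanishing at 0, of N + 1 times the pairing with (X - x)^N. *)
pose Psi : {poly Ri} :=
  \sum_(i < N.+1) (('C(N.+1, i.+1)%:R * (-1) ^+ i * nu (N - i)%N) *: 'X^(i.+1)).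
have polars_binom (M : nat) c : polars ws (('X + c%:P) ^+ M) =
    \sum_(i < M.+1) ('C(M, i)%:R * c ^+ i * nu (M - i)%N).
  rewrite exprDn polars_sum; apply: eq_bigr => i _.
  by rewrite -polarsZ -scalerA scaler_nat -mul_polyC rmorphXn /= mulrC.
have HPsi : Psi^`() = (N.+1%:R * N`!%:R * (-1) ^+ N) *: \prod_(w <- ws) ('X - w%:P).
  apply/eqP; rewrite -subr_eq0; apply/eqP; apply: horner_eq0 => x.
  rewrite !hornerE; apply/eqP; rewrite subr_eq0; apply/eqP.
  have -> : Psi^`().[x] = N.+1%:R * polars ws (('X - x%:P) ^+ N).
    rewrite -polyCN polars_binom mulr_sumr raddf_sum /= horner_sum; apply: eq_bigr => i _.
    rewrite derivZ derivXn /= hornerZ hornerMn hornerXn mulrnAr -mulr_natl !mulrA -natrM.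
    rewrite -mul_bin_diag /= natrM (exprNn x) -!mulrA; congr (_ * (_ * (_ * _))).
    by rewrite mulrC.
  rewrite polars_exp -!mulrA; do 2!congr (_ * _).
  rewrite horner_prod /N; elim: (ws) => [|w s IH]; first by rewrite !big_nil mulr1.
  by rewrite !big_cons IH /= exprS hornerXsubC [RHS]mulrACA mulN1r opprB.
exists (N.+1%:R * N`!%:R * (-1) ^+ N).
  by rewrite !mulf_neq0 ?signr_eq0 // pnatr_eq0 -lt0n ?fact_gt0.
set l := (X in X * _ = _).
have Hconst : l *: q - k *: Psi = ((l *: q - k *: Psi)`_0)%:P.
  by apply: deriv_eq0; rewrite derivB !derivZ Hq HPsi !scalerA mulrC subrr.
have -> : l * (q.[1] - q.[-1]) = k * (Psi.[1] - Psi.[-1]).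
  have H x : l * q.[x] = k * Psi.[x] + (l *: q - k *: Psi)`_0.
    have := congr1 (fun p => p.[x]) Hconst; rewrite /= hornerC => <-.
    by rewrite hornerD hornerN !hornerZ addrC subrK.
  by rewrite !mulrBr !H opprD addrACA subrr addr0.
congr (_ * _); rewrite polarsB.
have := polars_binom N.+1 1; rewrite polyC1 => ->.
have := polars_binom N.+1 (-1); rewrite polyCN polyC1 => ->.
(* The X^(N+1) terms of the two binomial expansions cancel; the others match [Psi] with indices
   shifted by one. *)
rewrite /Psi !horner_sum -!sumrB [RHS]big_ord_recl /= !expr0 subrr add0r.
apply: eq_bigr => i _; rewrite /bump /= add1n subSS !hornerZ !hornerXn !expr1n exprS mulN1r.
rewrite !mulr1 !mulrN !mulNr !opprK addrC; congr (_ + _).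
by rewrite mulrAC -(mulrA _ (_ ^+ _) (_ ^+ _)) -expr2 sqrr_sign mulr1.
Qed.

Lemma lead_coef_exp_XsubC n (a : Ri) : (('X - a%:P) ^+ n)`_n = 1.
Proof.
by have /monicP := monic_exp n (monicXsubC a); rewrite lead_coefE size_exp_XsubC.
Qed.

Lemma subleading_coef_exp_XsubC n (a : Ri) : (('X - a%:P) ^+ n.+1)`_n = - (a *+ n.+1).
Proof.
elim: n => [|n IH]; first by rewrite expr1 coefB coefX coefC sub0r.
by rewrite exprS mulrBl coefB coefXM coefCM /= IH lead_coef_exp_XsubC mulr1 -opprD -mulrSr.
Qed.

(** The polynomial (X + 1)^(N+1) - (X - 1)^(N+1) has degree exactly N and purely imaginary zeros,
    hence zeros in the closed right half-plane, so [polars_neq0] applies to it. *)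
Lemma symmetric_increment_neq0 ws (q : {poly Ri}) k :
  k != 0 -> (forall w, w \in ws -> left w) ->
  q^`() = k *: \prod_(w <- ws) ('X - w%:P) -> q.[1] != q.[-1].
Proof.
move=> k0 Hw /symmetric_increment[l l0 Hl].
rewrite -subr_eq0; apply/eqP => E; move: Hl; rewrite E mulr0 => /esym/eqP.
rewrite mulf_eq0 (negbTE k0) /=; apply/negP.
set N := size ws; set g := ('X + 1) ^+ N.+1 - _.
have gE : g = ('X - (-1)%:P) ^+ N.+1 - ('X - 1%:P) ^+ N.+1 by rewrite polyCN opprK polyC1.
have szg : size g = N.+1.
  apply/eqP; rewrite eqn_leq; apply/andP; split.
    apply/leq_sizeP => i; rewrite leq_eqVlt gE coefB => /orP[/eqP <-|lt].
      by rewrite !lead_coef_exp_XsubC subrr.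
    by rewrite !nth_default ?size_exp_XsubC ?subrr.
  rewrite ltnNge; apply/negP => /leq_sizeP/(_ N (leqnn _)) /eqP.
  rewrite gE coefB !subleading_coef_exp_XsubC mulNrn !opprK -mulr2n.
  by rewrite !mulrn_eq0 oner_eq0.
have [s Hs] := closed_field_poly_normal g.
have lg : lead_coef g != 0 by rewrite lead_coef_eq0 -size_poly_gt0 szg.
rewrite Hs; apply: polars_neq0 => //.
  by have := szg; rewrite Hs size_scale // size_prod_XsubC => -[].
move=> z Hz; have : root g z by rewrite Hs rootZ // root_prod_XsubC.
rewrite /root /g !hornerE subr_eq0 => /eqP; exact: expr_eq_right.
Qed.

Lemma croots_symmetric_increment_neq0 (rs ws : list C) (k : C) :
  k <> Complex.RtoC (IZR Z0) -> (forall w, List.In w ws -> Rlt (fst w) (IZR Z0)) ->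
  (forall x, RootLists.croots_deriv rs x = Complex.Cmult k (RootLists.croots ws x)) ->
  RootLists.croots rs (Complex.RtoC (INR 1)) <>
  RootLists.croots rs (Complex.Copp (Complex.RtoC (INR 1))).
Proof.
move=> k0 Hw Hd E.
have : (\prod_(r <- map toRi rs) ('X - r%:P)).[1] != (\prod_(r <- map toRi rs) ('X - r%:P)).[-1].
  apply: (@symmetric_increment_neq0 (map toRi ws) _ (toRi k)).
  - apply/eqP => Ek; apply: k0; apply: (can_inj toRiK); rewrite Ek.
    by rewrite -[RHS]/(toRi (Complex.RtoC (INR 0))) toRi_nat.
  - move=> w /mapP[r]; rewrite /left => Hr ->; rewrite toRiK; apply: Hw.
    by elim: (ws) Hr => [//|y s IH]; rewrite inE => /orP[/eqP ->|/IH]; [left|right].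
  - apply/eqP; rewrite -subr_eq0; apply/eqP; apply: horner_eq0 => x.
    rewrite !hornerE -[x]ofRiK -toRi_croots_deriv -toRi_croots Hd toRiM subrr //.
move/eqP; apply; have := congr1 toRi E; rewrite !toRi_croots.
by rewrite -[toRi (Complex.Copp _)]/(- toRi _) toRi_nat.
Qed.
End Grace.

(** * Mean value inequality for complex functions of a real variable *)

Module Sendov.
Import Coquelicot.Coquelicot RootLists RootBounds.
Local Open Scope C_scope.

Definition cderive (f : R -> C) (t : R) (l : C) : Prop :=
  is_derive (fun x => fst (f x)) t (fst l) /\ is_derive (fun x => snd (f x)) t (snd l).

Lemma is_derive_Rmult (f g : R -> R) (t l m : R) :
  is_derive f t l -> is_derive g t m ->
  is_derive (fun x => f x * g x)%R t (l * g t + f t * m)%R.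
Proof. intros Hf Hg. exact (is_derive_mult f g t l m Hf Hg Rmult_comm). Qed.

Lemma cderive_const (p : C) (t : R) : cderive (fun _ => p) t 0.
Proof. split; exact (is_derive_const _ _). Qed.

Lemma cderive_minus (f g : R -> C) (t : R) (l m : C) :
  cderive f t l -> cderive g t m -> cderive (fun x => f x - g x) t (l - m).
Proof. intros [] []; split; simpl; now apply @is_derive_minus. Qed.

Lemma cderive_mult (f g : R -> C) (t : R) (l m : C) :
  cderive f t l -> cderive g t m -> cderive (fun x => f x * g x) t (l * g t + f t * m).
Proof.
  intros [Hf1 Hf2] [Hg1 Hg2]; split; simpl.
  - evar_last.
    + apply @is_derive_minus; apply is_derive_Rmult; eassumption.
    + simpl. unfold minus, plus, opp; simpl. ring.
  - evar_last.
    + apply @is_derive_plus; apply is_derive_Rmult; eassumption.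
    + simpl. unfold plus; simpl. ring.
Qed.

Lemma cderive_croots (rs : list C) (f : R -> C) (t : R) (l : C) :
  cderive f t l -> cderive (fun x => croots rs (f x)) t (l * croots_deriv rs (f t)).
Proof.
  intros Hf. induction rs as [|r rs IH]; simpl.
  - rewrite Cmult_0_r. apply cderive_const.
  - replace (l * (croots rs (f t) + (f t - r) * croots_deriv rs (f t))) with
      ((l - 0) * croots rs (f t) + (f t - r) * (l * croots_deriv rs (f t))) by ring.
    apply (cderive_mult (fun x => f x - r)); [|exact IH].
    apply (cderive_minus f (fun _ => r)); [exact Hf|apply cderive_const].
Qed.

Local Close Scope C_scope.

Lemma mean_value (f df : R -> R) (x y : R) :
  x < y -> (forall t, x <= t <= y -> is_derive f t (df t)) ->
  exists t, x < t < y /\ f y - f x = df t * (y - x).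
Proof.
  intros Hxy Hd.
  destruct (MVT_cor2 f df x y Hxy) as [t [H1 H2]].
  - intros t Ht. now apply is_derive_Reals, Hd.
  - exists t. split; easy.
Qed.

Lemma derive_nonneg_le (f df : R -> R) (x y : R) :
  x <= y -> (forall t, x <= t <= y -> is_derive f t (df t)) ->
  (forall t, x <= t <= y -> 0 <= df t) -> f x <= f y.
Proof.
  intros [Hxy| ->] Hd Hpos; [|lra].
  destruct (mean_value f df x y Hxy Hd) as [t [Ht E]].
  assert (0 <= df t) by (apply Hpos; lra). nra.
Qed.

(** With d the increment of f, the real function |d| b - <d, f> is nondecreasing by Cauchy-Schwarz,
    and its increment is |d| (b y - b x) - |d|^2. *)
Lemma cderive_bound (f df : R -> C) (b db : R -> R) (x y : R) :
  x <= y ->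
  (forall t, x <= t <= y -> cderive f t (df t)) ->
  (forall t, x <= t <= y -> is_derive b t (db t)) ->
  (forall t, x <= t <= y -> Cmod (df t) <= db t) ->
  Cmod (f y - f x)%C <= b y - b x.
Proof.
  intros Hxy Hf Hb Hle.
  set (d := (f y - f x)%C).
  assert (Hmono : b x <= b y).
  { apply (derive_nonneg_le b db); auto.
    intros t Ht. eapply Rle_trans; [apply Cmod_ge_0|now apply Hle]. }
  assert (H : Cmod d * b x - (fst d * fst (f x) + snd d * snd (f x)) <=
              Cmod d * b y - (fst d * fst (f y) + snd d * snd (f y))).
  { apply (derive_nonneg_le
      (fun t => Cmod d * b t - (fst d * fst (f t) + snd d * snd (f t)))
      (fun t => Cmod d * db t - (fst d * fst (df t) + snd d * snd (df t)))); trivial.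
    - intros t Ht. specialize (Hb t Ht). destruct (Hf t Ht) as [H1 H2].
      apply @is_derive_minus; [now apply @is_derive_scal|].
      apply @is_derive_plus; now apply @is_derive_scal.
    - intros t Ht. specialize (Hle t Ht).
      pose proof (Cmod_ge_0 d). pose proof (Cmod_ge_0 (df t)).
      pose proof (Cmod_sqr d) as E1. pose proof (Cmod_sqr (df t)) as E2.
      assert (fst d * fst (df t) + snd d * snd (df t) <= Cmod d * Cmod (df t)).
      { apply Rsqr_incr_0_var; [|nra]. unfold Rsqr.
        replace (Cmod d * Cmod (df t) * (Cmod d * Cmod (df t))) with
          ((Cmod d * Cmod d) * (Cmod (df t) * Cmod (df t))) by ring.
        rewrite E1, E2.
        pose proof (Rle_0_sqr (fst d * snd (df t) - snd d * fst (df t))) as Hq.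
        unfold Rsqr in Hq. nra. }
      nra. }
  pose proof (Cmod_ge_0 d) as Hd0. pose proof (Cmod_sqr d) as E.
  assert (E' : fst d * fst d + snd d * snd d =
    (fst d * fst (f y) + snd d * snd (f y)) - (fst d * fst (f x) + snd d * snd (f x))).
  { unfold d; simpl; ring. }
  destruct Hd0 as [Hd0|Hd0]; [|lra].
  apply (Rmult_le_reg_l (Cmod d)); [easy|]. lra.
Qed.

Local Open Scope C_scope.

(** * Affine changes of variable and the bisector form of Grace's theorem *)

Lemma croots_affine (rs : list C) (m k x : C) : k <> 0 ->
  croots rs (m + x * k) = k ^ length rs * croots (map (fun r => (r - m) * / k) rs) x.
Proof.
  intros Hk. induction rs as [|r rs IH]; simpl; [ring|].
  rewrite IH. field. exact Hk.
Qed.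

Lemma croots_deriv_affine (rs : list C) (m k x : C) : k <> 0 ->
  k * croots_deriv rs (m + x * k) =
  k ^ length rs * croots_deriv (map (fun r => (r - m) * / k) rs) x.
Proof.
  intros Hk. induction rs as [|r rs IH]; simpl; [ring|].
  rewrite croots_affine by easy.
  transitivity (k * (k ^ length rs * croots (map (fun r0 => (r0 - m) * / k) rs) x) +
    (m + x * k - r) * (k * croots_deriv rs (m + x * k))); [ring|].
  rewrite IH. field. exact Hk.
Qed.

Lemma Cmult_cancel_l (k x y : C) : k <> 0 -> k * x = k * y -> x = y.
Proof.
  intros Hk E. replace x with (/ k * (k * x)) by (field; exact Hk). rewrite E.
  field. exact Hk.
Qed.

Lemma two_neq0 : RtoC 2 <> 0.
Proof. intros H. injection H. lra. Qed.

(* Grace's theorem on the chord from [z] to [a], normalized to the one from -1 to 1. *)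
Lemma bisector (rs ws : list C) (k a z : C) :
  ws <> nil -> k <> 0 -> (forall x, croots_deriv rs x = k * croots ws x) ->
  (forall w, In w ws -> Cmod (z - w) < Cmod (a - w))%R ->
  croots rs z <> croots rs a.
Proof.
  intros Hne Hk Hd Hw E.
  assert (Hlt : exists w, In w ws) by (destruct ws as [|w ?]; [easy|exists w; now left]).
  destruct Hlt as [w0 Hw0].
  pose proof two_neq0 as H2.
  remember ((a - z) * / 2) as h eqn:Eh. remember ((a + z) * / 2) as m eqn:Em.
  assert (Hh : h <> 0).
  { intros Hh. specialize (Hw w0 Hw0).
    replace z with a in Hw; [lra|].
    replace a with (z + 2 * h) by (rewrite Eh; field; exact H2).
    rewrite Hh. ring. }
  assert (Hpow : forall n, h ^ n <> 0) by (intros; now apply Cpow_nz).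
  (* The substitution m + x h sends -1 to z and 1 to a. The constant collects the scalings of both
     products and the chain-rule factor h. *)
  apply (Grace.croots_symmetric_increment_neq0 (map (fun r => (r - m) * / h) rs)
    (map (fun w => (w - m) * / h) ws) (/ h ^ length rs * (h * k * h ^ length ws))).
  - apply Cmult_neq_0; [|apply Cmult_neq_0; [now apply Cmult_neq_0|easy]].
    intros Hi. apply C1_nz. rewrite <- (Cinv_l (h ^ length rs)) by easy.
    rewrite Hi. ring.
  - intros w Hin. apply in_map_iff in Hin. destruct Hin as [v [<- Hv]].
    specialize (Hw v Hv). change (Re ((v - m) * / h) < 0)%R. rewrite Re_mult_inv.
    assert (Hpos : (0 < Cmod h)%R) by now apply Cmod_gt_0.
    apply Rdiv_neg_pos; [|now apply Rmult_lt_0_compat].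
    apply Rsqr_incrst_1 in Hw; try apply Cmod_ge_0. unfold Rsqr in Hw.
    rewrite !Cmod_sqr in Hw.
    assert (E1 : a = m + h) by (rewrite Em, Eh; field; exact H2).
    assert (E2 : z = m - h) by (rewrite Em, Eh; field; exact H2).
    rewrite E1, E2 in Hw. clear - Hw.
    destruct m as [m1 m2], h as [h1 h2], v as [v1 v2]. simpl in *. lra.
  - intros x. apply (Cmult_cancel_l (h ^ length rs)); [easy|].
    rewrite <- croots_deriv_affine by easy.
    rewrite Hd, croots_affine by easy. field. easy.
  - apply (Cmult_cancel_l (h ^ length rs)); [easy|].
    rewrite <- !croots_affine by easy.
    replace (m + INR 1 * h) with a by (rewrite Em, Eh; simpl INR; field; exact H2).
    replace (m + - INR 1 * h) with z by (rewrite Em, Eh; simpl INR; field; exact H2).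
    now symmetry.
Qed.

Local Close Scope C_scope.

(** * The lune of critical points and the decay of P' along the segment from a to 0 *)

Definition critical_region (a : R) (w : C) : Prop := Cmod w <= 1 /\ 1 < Cmod (a - w)%C.

Section CriticalRegion.
Context (a : R) (Ha : 0 < a < 1).

Lemma critical_region_Re (w : C) : critical_region a w -> fst w < a / 2.
Proof.
  intros [H1 H2]. pose proof (Cmod_ge_0 w).
  apply Rsqr_incrst_1 in H2; try lra; try apply Cmod_ge_0.
  apply Rsqr_incr_1 in H1; try lra. unfold Rsqr in *. rewrite Cmod_sqr in *.
  destruct w as [x y]. simpl in *. nra.
Qed.

Lemma critical_region_dist (w : C) : critical_region a w -> 1 < Cmod (a - w)%C <= 1 + a.
Proof.
  intros [H1 H2]. split; [easy|].
  pose proof (Cmod_triangle a (- w)%C) as H. rewrite Cmod_opp, Cmod_R, Rabs_pos_eq in H by lra.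
  unfold Cminus. lra.
Qed.

Lemma segment_dist_sqr (w : C) (t : R) :
  Cmod (t - w)%C * Cmod (t - w)%C =
    Cmod (a - w)%C * Cmod (a - w)%C - (a - t) * (a + t - 2 * fst w).
Proof. rewrite !Cmod_sqr. destruct w as [x y]. simpl. ring. Qed.

(** By [segment_dist_sqr], the ratio of the squared distances is 1 minus the right side of the
    hypothesis, hence at most 1 - 2 e <= exp (-2 e). *)
Lemma critical_region_decay (w : C) (t e : R) :
  critical_region a w ->
  2 * e <= (a - t) * (a + t - 2 * fst w) / (Cmod (a - w)%C * Cmod (a - w)%C) ->
  0 <= Cmod (t - w)%C <= Cmod (a - w)%C * exp (- e).
Proof.
  intros Hw He. split; [apply Cmod_ge_0|].
  destruct (critical_region_dist w Hw) as [Hd _].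
  apply Rsqr_incr_0_var.
  2: { apply Rmult_le_pos; [lra|]. left; apply exp_pos. }
  unfold Rsqr. rewrite segment_dist_sqr.
  set (d := Cmod (a - w)%C) in *.
  assert (Hd2 : 0 < d * d) by nra.
  apply Rle_div_r in He; [|easy].
  replace (d * exp (- e) * (d * exp (- e))) with (d * d * exp (- (2 * e))).
  2: { replace (- (2 * e)) with (- e + - e) by ring. rewrite exp_plus. ring. }
  pose proof (exp_ineq1_le (- (2 * e))). nra.
Qed.

Lemma rprod_decay (f g e : C -> R) (ws : list C) :
  (forall w, In w ws -> 0 <= f w <= g w * exp (- e w)) ->
  rprod f ws <= rprod g ws * exp (- rsum e ws).
Proof.
  intros H. replace (rprod g ws * exp (- rsum e ws)) with (rprod (fun w => g w * exp (- e w)) ws).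
  - now apply rprod_le.
  - rewrite rprod_mult. f_equal. clear H. induction ws as [|w ws IH]; simpl.
    + now rewrite Ropp_0, exp_0.
    + rewrite IH, <- exp_plus. f_equal. ring.
Qed.

Definition inv_dist2 (w : C) : R := / (Cmod (a - w)%C * Cmod (a - w)%C).

(** Since Re w < a / 2, the factor a + t - 2 Re w exceeds t. The sum of [inv_dist2] is kept in the
    rate because it also bounds the variation in [log_deriv_variation]; a lower bound on it is then
    all that Laplace's method needs. *)
Lemma critical_prod_decay_near (ws : list C) (t : R) :
  (forall w, In w ws -> critical_region a w) -> 0 <= t <= a ->
  rprod (fun w => Cmod (t - w)%C) ws <=
  rprod (fun w => Cmod (a - w)%C) ws * exp (- ((a - t) * t / 2 * rsum inv_dist2 ws)).
Proof.
  intros Hws Ht. rewrite <- rsum_scal. apply rprod_decay. intros w Hin.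
  specialize (Hws w Hin). apply critical_region_decay; [easy|].
  pose proof (critical_region_Re w Hws). destruct (critical_region_dist w Hws) as [Hd _].
  unfold inv_dist2, Rdiv.
  assert (HI : 0 < / (Cmod (a - w)%C * Cmod (a - w)%C)) by (apply Rinv_0_lt_compat; nra).
  set (I := / (Cmod (a - w)%C * Cmod (a - w)%C)) in *.
  replace (2 * ((a - t) * t * / 2 * I)) with ((a - t) * t * I) by field.
  apply Rmult_le_compat_r; [lra|]. apply Rmult_le_compat_l; lra.
Qed.

(** Bounding |a - w| by 1 + a brings in the mean of Re w. Once that mean is at most a / 4, the rate
    stays positive down to t = 0, where the rate of [critical_prod_decay_near] vanishes. *)
Lemma critical_prod_decay_mean (ws : list C) (t : R) :
  (forall w, In w ws -> critical_region a w) -> 0 <= t <= a ->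
  rprod (fun w => Cmod (t - w)%C) ws <=
  rprod (fun w => Cmod (a - w)%C) ws *
    exp (- ((a - t) / (2 * (1 + a) ^ 2) * (INR (length ws) * (a + t) - 2 * rsum fst ws))).
Proof.
  intros Hws Ht.
  replace (INR (length ws) * (a + t) - 2 * rsum fst ws) with
    (rsum (fun w => (a + t) + (-2) * fst w) ws) by (rewrite rsum_affine; ring).
  rewrite <- rsum_scal. apply rprod_decay. intros w Hin.
  specialize (Hws w Hin). apply critical_region_decay; [easy|].
  pose proof (critical_region_Re w Hws). destruct (critical_region_dist w Hws) as [Hd Hd'].
  assert (Hd2 : Cmod (a - w)%C * Cmod (a - w)%C <= (1 + a) ^ 2) by nra.
  assert (Hi : / (1 + a) ^ 2 <= / (Cmod (a - w)%C * Cmod (a - w)%C))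
    by (apply Rinv_le_contravar; nra).
  replace (2 * ((a - t) / (2 * (1 + a) ^ 2) * (a + t + -2 * fst w))) with
    ((a - t) * (a + t - 2 * fst w) * / (1 + a) ^ 2) by (field; lra).
  apply Rmult_le_compat_l; [|easy]. apply Rmult_le_pos; lra.
Qed.

Lemma rsum_inv_dist2_ge (ws : list C) :
  (forall w, In w ws -> critical_region a w) ->
  INR (length ws) / (1 + a) ^ 2 <= rsum inv_dist2 ws.
Proof.
  intros Hws. unfold Rdiv. rewrite <- rsum_const. apply rsum_le. intros w Hin.
  destruct (critical_region_dist w (Hws w Hin)). apply Rinv_le_contravar; nra.
Qed.

Definition log_deriv (ws : list C) (x : C) : C := csum (fun w => / (x - w))%C ws.

(** All terms have positive real part, since Re w < a / 2 < a. *)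
Lemma log_deriv_neq0 (ws : list C) :
  ws <> nil -> (forall w, In w ws -> critical_region a w) -> log_deriv ws a <> 0%C.
Proof.
  intros Hne Hws E. apply (f_equal Re) in E. unfold log_deriv in E. rewrite Re_csum in E.
  assert (H : forall w, In w ws -> 0 < Re (/ (a - w))%C).
  { intros w Hin. specialize (Hws w Hin). rewrite Re_inv.
    pose proof (critical_region_Re w Hws). destruct (critical_region_dist w Hws).
    apply Rdiv_lt_0_compat; [simpl; lra|nra]. }
  change (Re 0%C) with 0 in E. clear Hws. destruct ws as [|w ws]; [easy|]. cbn [rsum] in E.
  assert (0 <= rsum (fun r => Re (/ (a - r))%C) ws).
  { replace 0 with (rsum (fun _ => 0) ws) by (rewrite rsum_const; ring).
    apply rsum_le. intros r Hr. left. apply H. now right. }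
  specialize (H w (or_introl eq_refl)). lra.
Qed.

Lemma log_deriv_le (ws : list C) :
  (forall w, In w ws -> critical_region a w) -> Cmod (log_deriv ws a) <= INR (length ws).
Proof.
  intros Hws. eapply Rle_trans; [apply Cmod_csum|].
  rewrite <- (Rmult_1_r (INR _)), <- rsum_const. apply rsum_le. intros w Hin.
  destruct (critical_region_dist w (Hws w Hin)).
  rewrite Cmod_inv by (apply Cmod_gt_0; lra).
  rewrite <- Rinv_1. apply Rinv_le_contravar; lra.
Qed.

Lemma segment_dist_ge (w : C) (t : R) :
  critical_region a w -> 0 <= t <= a -> Cmod (a - w)%C * (1 - (a - t)) <= Cmod (t - w)%C.
Proof.
  intros Hw Ht. destruct (critical_region_dist w Hw).
  pose proof (Cmod_minus_ge (a - w)%C (RtoC (a - t))) as H1.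
  rewrite Cmod_R, Rabs_pos_eq in H1 by lra.
  replace (a - w - RtoC (a - t))%C with (t - w)%C in H1 by (rewrite RtoC_minus; ring).
  nra.
Qed.

Lemma log_deriv_variation (ws : list C) (t : R) :
  (forall w, In w ws -> critical_region a w) -> 2 * a / 5 <= t <= a ->
  Cmod (log_deriv ws a - log_deriv ws t)%C <= (a - t) * (5 / 2 * rsum inv_dist2 ws).
Proof.
  intros Hws Ht.
  assert (E : (log_deriv ws a - log_deriv ws t = csum (fun w => / (a - w) - / (t - w)) ws)%C).
  { unfold log_deriv. clear. induction ws as [|w ws IH]; simpl; [ring|]. rewrite <- IH. ring. }
  rewrite E. eapply Rle_trans; [apply Cmod_csum|].
  rewrite <- !rsum_scal. apply rsum_le. intros w Hin. specialize (Hws w Hin).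
  destruct (critical_region_dist w Hws) as [Hd _].
  pose proof (segment_dist_ge w t Hws ltac:(lra)) as Hs.
  assert (Ht0 : 0 < Cmod (t - w)%C) by nra.
  assert (N1 : (a - w <> 0)%C) by (apply Cmod_gt_0; lra).
  assert (N2 : (t - w <> 0)%C) by (apply Cmod_gt_0; lra).
  replace (/ (a - w) - / (t - w))%C with (RtoC (t - a) * / ((a - w) * (t - w)))%C
    by (rewrite RtoC_minus; field; now split).
  rewrite Cmod_mult, Cmod_inv, Cmod_mult, Cmod_R by now apply Cmult_neq_0.
  rewrite Rabs_left1 by lra. replace (- (t - a)) with (a - t) by ring.
  apply Rmult_le_compat_l; [lra|]. unfold inv_dist2.
  set (d := Cmod (a - w)%C) in *.
  (* Here a - t <= 3 a / 5 < 3 / 5, so |t - w| is at least 2/5 of |a - w|. *)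
  replace (5 / 2 * / (d * d)) with (/ (d * (d * (2 / 5)))) by (field; lra).
  apply Rinv_le_contravar; [nra|]. apply Rmult_le_compat_l; [lra|]. nra.
Qed.

End CriticalRegion.

(** * Laplace's method for P *)

Lemma cderive_RtoC (t : R) : cderive RtoC t 1%C.
Proof. split; simpl; [apply @is_derive_id|apply @is_derive_const]. Qed.

Lemma cderive_croots_R (rs : list C) (t : R) :
  cderive (fun x : R => croots rs x) t (croots_deriv rs t).
Proof.
  rewrite <- (Cmult_1_l (croots_deriv rs t)).
  apply (cderive_croots rs RtoC), cderive_RtoC.
Qed.

Lemma exp_le_compat (x y : R) : x <= y -> exp x <= exp y.
Proof. intros [H| ->]; [left; now apply exp_increasing|lra]. Qed.

Lemma exp_neg_le_pow4 (x : R) : 0 <= x -> exp (- x) <= / (1 + x / 4) ^ 4.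
Proof.
  intros Hx. rewrite exp_Ropp. apply Rinv_le_contravar; [apply pow_lt; lra|].
  replace (exp x) with (exp (x / 4) ^ 4).
  - apply pow_incr. split; [lra|]. apply exp_ineq1_le.
  - simpl. rewrite Rmult_1_r, <- !exp_plus. f_equal. field.
Qed.

(* Laplace's method: [P - P' / S(a)], where [S = P'' / P'], has the small derivative
   [P' (1 - S / S(a))] on the segment, while [P'] decays exponentially away from [a]. *)
Lemma laplace_lower_bound (a k : R) (rs ws : list C) :
  0 < a < 1 -> 0 < k -> ws <> nil -> (forall w, In w ws -> critical_region a w) ->
  (forall x, croots_deriv rs x = k * croots ws x)%C -> croots rs a = 0%C ->
  80 <= a ^ 2 * rsum (inv_dist2 a) ws ->
  / 5 * (k * rprod (fun w => Cmod (a - w)%C) ws / Cmod (log_deriv ws a)) <=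
    Cmod (croots rs (2 * a / 5)%R).
Proof.
  intros Ha Hk Hne Hws Hd Hroot Hy.
  pose proof (log_deriv_neq0 a Ha ws Hne Hws) as HS.
  pose proof (proj1 (Cmod_gt_0 _) HS) as HSpos.
  set (S0 := log_deriv ws a) in *.
  set (D := rsum (inv_dist2 a) ws) in *.
  set (A := k * rprod (fun w => Cmod (a - w)%C) ws / Cmod S0).
  assert (Hprod : 0 < rprod (fun w => Cmod (a - w)%C) ws).
  { apply rprod_pos. intros w Hin. destruct (critical_region_dist a Ha w (Hws w Hin)). lra. }
  assert (HA : 0 < A) by (apply Rdiv_lt_0_compat; [now apply Rmult_lt_0_compat|easy]).
  assert (HD : 0 < D) by nra.
  set (t0 := 2 * a / 5).
  set (f := fun t : R => (croots rs t - (k * / S0) * croots ws t)%C).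
  set (df := fun t : R => (k * croots ws t - (k * / S0) * croots_deriv ws t)%C).
  assert (Hf : forall t : R, cderive f t (df t)).
  { intros t. unfold f, df. rewrite <- Hd.
    apply cderive_minus; [apply cderive_croots_R|].
    replace (k * / S0 * croots_deriv ws t)%C with
      (0 * croots ws t + (k * / S0) * croots_deriv ws t)%C by ring.
    apply (cderive_mult (fun _ => (k * / S0)%C)); [apply cderive_const|apply cderive_croots_R]. }
  assert (Hnz : forall t, t0 <= t <= a -> forall w, In w ws -> (t - w <> 0)%C).
  { intros t Ht w Hin. apply Cmod_gt_0. unfold t0 in Ht.
    pose proof (segment_dist_ge a Ha w t (Hws w Hin) ltac:(lra)).
    destruct (critical_region_dist a Ha w (Hws w Hin)). nra. }
  assert (Hmod : forall t : R, Cmod (k * / S0 * croots ws t)%C =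
     k / Cmod S0 * rprod (fun w => Cmod (t - w)%C) ws).
  { intros t. rewrite !Cmod_mult, Cmod_inv, Cmod_R, Rabs_pos_eq, Cmod_croots by (easy || lra).
    reflexivity. }
  assert (Hdec : forall t, t0 <= t <= a ->
     k / Cmod S0 * rprod (fun w => Cmod (t - w)%C) ws <= A * exp (- ((a - t) * t / 2 * D))).
  { intros t Ht. unfold A, t0 in *.
    replace (k * rprod (fun w => Cmod (a - w)%C) ws / Cmod S0 * exp (- ((a - t) * t / 2 * D)))
      with (k / Cmod S0 * (rprod (fun w => Cmod (a - w)%C) ws * exp (- ((a - t) * t / 2 * D))))
      by (field; lra).
    apply Rmult_le_compat_l; [left; now apply Rdiv_lt_0_compat|].
    apply critical_prod_decay_near; trivial. lra. }
  (* For t >= 2 a / 5 the decay exponent (a - t) t D / 2 is at least q (a - t). *)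
  set (q := a * D / 5).
  assert (Hq : 0 < q) by (unfold q; nra).
  (* An antiderivative of [db]. Its value at a is A (5/2) D / q^2 = (125/2) A / (a^2 D), at most
     (50/64) A because a^2 D >= 80. *)
  set (b := fun t => A * (5 / 2 * D) * (((a - t) / q + / q ^ 2) * exp (- (q * (a - t))))).
  set (db := fun t => A * (5 / 2 * D) * ((a - t) * exp (- (q * (a - t))))).
  assert (Hb : forall t, is_derive b t (db t)).
  { intros t. unfold b, db. auto_derive; [lra|]. change (a + - t) with (a - t). field. lra. }
  assert (Hle : forall t, t0 <= t <= a -> Cmod (df t) <= db t).
  { intros t Ht. unfold df. rewrite croots_deriv_log by (now apply Hnz).
    replace (k * croots ws t - k * / S0 * (croots ws t * csum (fun r => / (t - r)) ws))%C with
      ((k * / S0 * croots ws t) * (S0 - log_deriv ws t))%C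
      by (unfold log_deriv; field; easy).
    rewrite Cmod_mult, Hmod.
    pose proof (log_deriv_variation a Ha ws t Hws Ht) as Hv. fold D S0 in Hv.
    assert (Hex : exp (- ((a - t) * t / 2 * D)) <= exp (- (q * (a - t)))).
    { apply exp_le_compat. unfold q, t0 in *.
      assert (0 <= (a - t) * D) by (apply Rmult_le_pos; lra). nra. }
    specialize (Hdec t Ht).
    eapply Rle_trans.
    - apply Rmult_le_compat; [|apply Cmod_ge_0|exact Hdec|exact Hv].
      rewrite <- Hmod. apply Cmod_ge_0.
    - unfold db.
      replace (A * (5 / 2 * D) * ((a - t) * exp (- (q * (a - t))))) with
        (A * exp (- (q * (a - t))) * ((a - t) * (5 / 2 * D))) by ring.
      apply Rmult_le_compat_r; [unfold t0 in Ht; apply Rmult_le_pos; lra|].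
      apply Rmult_le_compat_l; lra. }
  assert (Ht0a : t0 <= a) by (unfold t0; lra).
  pose proof (cderive_bound f df b db t0 a Ht0a (fun t _ => Hf t) (fun t _ => Hb t) Hle) as HG.
  assert (Hbt : 0 <= b t0).
  { unfold b. apply Rmult_le_pos; [apply Rmult_le_pos; lra|].
    apply Rmult_le_pos; [|left; apply exp_pos].
    apply Rplus_le_le_0_compat.
    - apply Rmult_le_pos; [lra|]. left; now apply Rinv_0_lt_compat.
    - left. apply Rinv_0_lt_compat. now apply pow_lt. }
  assert (Hba : b a <= A * (50 / 64)).
  { unfold b. rewrite Rminus_diag, Rmult_0_r, Ropp_0, exp_0.
    replace (A * (5 / 2 * D) * ((0 / q + / q ^ 2) * 1)) with (A * (125 / 2 * / (a ^ 2 * D))).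
    2: { unfold q. field. lra. }
    apply Rmult_le_compat_l; [lra|].
    assert (/ (a ^ 2 * D) <= / 80) by (apply Rinv_le_contravar; lra). lra. }
  assert (Hfa : Cmod (f a) = A).
  { unfold f. rewrite Hroot. replace (0 - k * / S0 * croots ws a)%C with
      (- (k * / S0 * croots ws a))%C by ring. rewrite Cmod_opp, Hmod. unfold A. field. lra. }
  assert (Hh : Cmod (k * / S0 * croots ws t0)%C <= A * / 100).
  { rewrite Hmod. eapply Rle_trans; [apply Hdec; lra|].
    apply Rmult_le_compat_l; [lra|].
    (* The exponent is at least 3/25 times 80, which is 48/5, and (1 + 12/5)^4 > 100. *)
    replace ((a - t0) * t0 / 2 * D) with (3 / 25 * (a ^ 2 * D)) by (unfold t0; field).
    eapply Rle_trans; [apply (exp_le_compat _ (- (48 / 5))); lra|].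
    eapply Rle_trans; [apply exp_neg_le_pow4; lra|].
    apply Rinv_le_contravar; lra. }
  (* What remains of A is the fraction 1 - 50/64 - 1/100 > 1/5. *)
  pose proof (Cmod_minus_ge (f a) (f a - f t0)%C) as H1.
  replace (f a - (f a - f t0))%C with (f t0) in H1 by ring.
  pose proof (Cmod_triangle (croots rs t0) (- (k * / S0 * croots ws t0))%C) as H2.
  rewrite Cmod_opp in H2. change (croots rs t0 + - (k * / S0 * croots ws t0))%C with (f t0) in H2.
  fold t0. lra.
Qed.

(** * Mean of the critical points and product of the zeros of a counterexample *)

Definition degree_condition (a : R) (n : nat) : Prop :=
  36 * (2 + a) ^ 2 <= INR n * a ^ 2 /\ 32 * ln (40 / a ^ 2) <= INR n * a ^ 2.

Lemma degree_condition_of_N1 (a : R) (n : nat) :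
  0 < a -> INR n >= Defs.N1 a -> degree_condition a n.
Proof.
  intros Ha Hn. unfold Defs.N1, Defs.N0 in Hn.
  pose proof (Rmax_l (9 * ((4 + 2 * a) / a) ^ 2) (32 * ln (40 / a ^ 2) / a ^ 2)).
  pose proof (Rmax_r (9 * ((4 + 2 * a) / a) ^ 2) (32 * ln (40 / a ^ 2) / a ^ 2)).
  assert (0 < a ^ 2) by nra.
  split.
  - replace (36 * (2 + a) ^ 2) with (9 * ((4 + 2 * a) / a) ^ 2 * a ^ 2) by (field; lra).
    apply Rmult_le_compat_r; lra.
  - replace (32 * ln (40 / a ^ 2)) with (32 * ln (40 / a ^ 2) / a ^ 2 * a ^ 2) by (field; lra).
    apply Rmult_le_compat_r; lra.
Qed.

(** The constant 80 is the one required by [laplace_lower_bound]. The inequality is tightest near a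
    = 1, where it reads 324 - 1 >= 320. *)
Lemma length_ge_of_degree_condition (a : R) (N : nat) :
  0 < a < 1 -> degree_condition a (S N) -> 80 * (1 + a) ^ 2 <= INR N * a ^ 2.
Proof. intros Ha [H _]. rewrite S_INR in H. nra. Qed.

Lemma rprod_ge1 (f : C -> R) (rs : list C) :
  (forall r, In r rs -> 1 <= f r) -> 1 <= rprod f rs.
Proof.
  induction rs as [|r rs IH]; simpl; intros H; [lra|].
  specialize (IH (fun s Hs => H s (or_intror Hs))). specialize (H r (or_introl eq_refl)). nra.
Qed.

Section Counterexample.
Context (a : R) (zs ws : list C).
Context (Ha : 0 < a < 1) (Hzs : forall z, In z zs -> Cmod z <= 1).
Context (Hws : forall w, In w ws -> critical_region a w).
Context (Hlen : length ws = length zs).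
Context (Hder : forall x,
  (croots_deriv (RtoC a :: zs) x = RtoC (INR (S (length zs))) * croots ws x)%C).
Context (Hsum : INR (length ws) * (a + rsum fst zs) = INR (S (length zs)) * rsum fst ws).
Context (Hdeg : degree_condition a (S (length zs))).

Let N := INR (length zs).
Let A := rprod (fun w => Cmod (a - w)%C) ws.

Lemma N_large : 80 * (1 + a) ^ 2 <= N * a ^ 2.
Proof. now apply length_ge_of_degree_condition. Qed.

Lemma N_pos : 80 <= N.
Proof. pose proof N_large. assert (0 <= N) by apply pos_INR. nra. Qed.

Lemma ws_not_nil : ws <> nil.
Proof.
  intros E. pose proof N_pos as H. unfold N in H. rewrite <- Hlen, E in H. simpl in H. lra.
Qed.

Lemma prod_dist_ge1 : 1 <= A.
Proof.
  apply rprod_ge1. intros w Hw. destruct (critical_region_dist a Ha w (Hws w Hw)). lra.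
Qed.

Lemma value_at_two_fifths : / 5 * ((N + 1) * A / N) <= Cmod (croots (RtoC a :: zs) (2 * a / 5)%R).
Proof.
  pose proof N_pos as HN. pose proof N_large as HN2.
  assert (Hk : 0 < INR (S (length zs))) by (rewrite S_INR; fold N; lra).
  assert (Hroot : croots (RtoC a :: zs) a = 0%C) by (apply croots_eq0; now left).
  assert (Hy : 80 <= a ^ 2 * rsum (inv_dist2 a) ws).
  { pose proof (rsum_inv_dist2_ge a Ha ws Hws) as H. rewrite Hlen in H. fold N in H.
    apply Rle_trans with (a ^ 2 * (N / (1 + a) ^ 2)).
    - replace (a ^ 2 * (N / (1 + a) ^ 2)) with (N * a ^ 2 / (1 + a) ^ 2) by (field; lra).
      apply (Rle_div_r 80 _ ((1 + a) ^ 2)); [nra|exact HN2].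
    - apply Rmult_le_compat_l; [nra|easy]. }
  pose proof (laplace_lower_bound a _ _ ws Ha Hk ws_not_nil Hws Hder Hroot Hy) as H.
  eapply Rle_trans; [|exact H]. apply Rmult_le_compat_l; [lra|].
  fold A. rewrite S_INR. fold N. apply Rmult_le_compat_l.
  - pose proof prod_dist_ge1. apply Rmult_le_pos; lra.
  - pose proof (log_deriv_le a Ha ws Hws) as Hl. rewrite Hlen in Hl. fold N in Hl.
    apply Rinv_le_contravar; [|easy].
    apply Cmod_gt_0, log_deriv_neq0; trivial. exact ws_not_nil.
Qed.

Lemma Cmod_croots_cons (t : R) :
  0 <= t <= a ->
  Cmod (croots (RtoC a :: zs) t) = (a - t) * rprod (fun z => Cmod (t - z)%C) zs.
Proof.
  intros Ht. simpl. rewrite Cmod_mult, Cmod_croots. f_equal.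
  rewrite <- RtoC_minus, Cmod_R, Rabs_left1; lra.
Qed.

(** For |z| <= 1, |t - z|^2 <= 1 + t^2 - 2 t Re z <= exp (t^2 - 2 t Re z), so zeros too far to the
    right would make |P(2a/5)| smaller than [value_at_two_fifths] allows. *)
Lemma mean_zeros_le : rsum fst zs <= N * a / 5 + 5 / a.
Proof.
  pose proof N_pos as HN. pose proof prod_dist_ge1 as HA.
  pose proof value_at_two_fifths as H. rewrite Cmod_croots_cons in H by lra.
  set (t := 2 * a / 5) in *.
  set (p := rprod (fun z => Cmod (t - z)%C) zs) in *.
  assert (H1 : 1 <= (N + 1) * A / N) by (apply (Rle_div_r 1 _ N); nra).
  (* The factor of P at its zero a is a - t = 3 a / 5 < 3 / 5. *)
  assert (Hp : / 3 <= p) by (unfold t in H; nra).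
  assert (Hup : p <= rprod (fun _ => 1) zs * exp (- rsum (fun z => - (t ^ 2 / 2) + t * fst z) zs)).
  { apply rprod_decay. intros z Hz. split; [apply Cmod_ge_0|].
    specialize (Hzs z Hz). pose proof (Cmod_ge_0 z).
    assert (Hz2 : Cmod z * Cmod z <= 1) by nra. rewrite Cmod_sqr in Hz2.
    rewrite Rmult_1_l. apply Rsqr_incr_0_var; [|left; apply exp_pos].
    unfold Rsqr. rewrite Cmod_sqr, <- exp_plus.
    match goal with |- _ <= exp ?x => pose proof (exp_ineq1_le x) end.
    destruct z as [x y]. simpl in *. nra. }
  rewrite rprod_const, pow1, Rmult_1_l, rsum_affine in Hup. fold N in Hup.
  assert (He : - (2) <= - (N * - (t ^ 2 / 2) + t * rsum fst zs)).
  { apply Rnot_lt_le. intros Hlt. apply exp_increasing in Hlt.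
    assert (exp (- (2)) <= / 3).
    { rewrite exp_Ropp. apply Rinv_le_contravar; [lra|]. pose proof (exp_ineq1_le 2). lra. }
    lra. }
  assert (Ht : 0 < t) by (unfold t; lra).
  apply (Rmult_le_reg_l t); [easy|].
  replace (t * (N * a / 5 + 5 / a)) with (N * (t ^ 2 / 2) + 2) by (unfold t; field; lra).
  lra.
Qed.

(** P and P' have the same mean of zeros. The gap between a / 5 and a / 4 absorbs 5 / a and the zero
    a, because n a^2 >= 36 (2 + a)^2. *)
Lemma mean_critical_points_le : rsum fst ws <= N * (a / 4).
Proof.
  pose proof N_pos as HN. pose proof mean_zeros_le as H.
  rewrite Hlen, S_INR in Hsum. fold N in Hsum.
  apply (Rmult_le_reg_l (N + 1)); [lra|]. rewrite <- Hsum.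
  replace ((N + 1) * (N * (a / 4))) with (N * ((N + 1) * (a / 4))) by ring.
  apply Rmult_le_compat_l; [lra|].
  destruct Hdeg as [Hd _]. rewrite S_INR in Hd. fold N in Hd.
  assert (a * (5 / a) = 5) by (field; lra).
  apply (Rmult_le_reg_l a); [lra|]. nra.
Qed.

Lemma Cmod_deriv_near_0 (t : R) : 0 <= t <= 2 * a / 5 ->
  Cmod (croots_deriv (RtoC a :: zs) t) <= (N + 1) * A * exp (- (N * a ^ 2 / 16)).
Proof.
  intros Ht. pose proof N_pos as HN. pose proof prod_dist_ge1 as HA.
  rewrite Hder, Cmod_mult, Cmod_R, Rabs_pos_eq, Cmod_croots, S_INR by apply pos_INR.
  fold N. rewrite Rmult_assoc. apply Rmult_le_compat_l; [lra|].
  eapply Rle_trans; [apply (critical_prod_decay_mean a Ha ws t Hws); lra|].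
  fold A. apply Rmult_le_compat_l; [lra|]. apply exp_le_compat, Ropp_le_contravar.
  rewrite Hlen. fold N. pose proof mean_critical_points_le as Hm.
  assert (H1 : a ^ 2 / 2 * N <= (a - t) * (N * (a + t) - 2 * rsum fst ws)).
  { apply Rle_trans with ((a - t) * (N * (a / 2 + t))).
    (* The difference is t (a / 2 - t), nonnegative since t <= 2 a / 5. *)
    - assert (a ^ 2 / 2 <= (a - t) * (a / 2 + t)) by nra. nra.
    - apply Rmult_le_compat_l; [lra|]. lra. }
  replace ((a - t) / (2 * (1 + a) ^ 2) * (N * (a + t) - 2 * rsum fst ws)) with
    ((a - t) * (N * (a + t) - 2 * rsum fst ws) / (2 * (1 + a) ^ 2)) by (field; lra).
  apply (Rle_div_r (N * a ^ 2 / 16) _ (2 * (1 + a) ^ 2)); [nra|].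
  apply Rle_trans with (a ^ 2 / 2 * N); [|exact H1].
  assert (0 <= N * a ^ 2 * (4 - (1 + a) ^ 2)) by (apply Rmult_le_pos; nra). lra.
Qed.

(** Half of the exponent absorbs the factor N, as x exp (-x) <= 1/e < 41/100; the other half is
    about a^2 / 40 at most, by the logarithmic term of [N1]. *)
Lemma exp_decay_small : N * a * exp (- (N * a ^ 2 / 16)) <= 17 / 50.
Proof.
  pose proof N_pos as HN. destruct Hdeg as [_ Hd]. rewrite S_INR in Hd. fold N in Hd.
  assert (Ha2 : 0 < a ^ 2) by nra.
  set (x := N * a ^ 2 / 32).
  replace (- (N * a ^ 2 / 16)) with (- x + - x) by (unfold x; field). rewrite exp_plus.
  assert (H1 : x * exp (- x) <= 41 / 100).
  { pose proof (exp_ineq1_le (x - 1)) as He. pose proof (exp_pos (- x)).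
    assert (E : exp (- x) * exp (x - 1) = exp (- (1))) by (rewrite <- exp_plus; f_equal; ring).
    assert (exp (- (1)) <= 41 / 100).
    { eapply Rle_trans; [apply exp_neg_le_pow4; lra|].
      replace (41 / 100) with (/ (100 / 41)) by field. apply Rinv_le_contravar; lra. }
    nra. }
  assert (H2 : exp (- x) <= a ^ 2 / 40 * (32 / 31)).
  { apply Rle_trans with (exp (- ln (40 / a ^ 2) + / 32)).
    - apply exp_le_compat. unfold x. nra.
    - assert (H40 : 0 < 40 / a ^ 2) by (apply Rdiv_lt_0_compat; lra).
      rewrite exp_plus, exp_Ropp, exp_ln by easy.
      replace (/ (40 / a ^ 2)) with (a ^ 2 / 40) by (field; lra).
      apply Rmult_le_compat_l; [lra|].
      pose proof (exp_ineq1_le (- / 32)) as He. pose proof (exp_pos (/ 32)).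
      assert (E : exp (/ 32) * exp (- / 32) = 1) by (rewrite <- exp_plus, Rplus_opp_r; apply exp_0).
      nra. }
  assert (Hx : 0 <= x * exp (- x)).
  { apply Rmult_le_pos; [unfold x; nra|left; apply exp_pos]. }
  assert (H3 : x * exp (- x) * exp (- x) <= 41 / 100 * (a ^ 2 / 40 * (32 / 31))).
  { apply Rmult_le_compat; trivial. left; apply exp_pos. }
  apply (Rmult_le_reg_l a); [lra|].
  replace (a * (N * a * (exp (- x) * exp (- x)))) with (32 * (x * exp (- x) * exp (- x)))
    by (unfold x; field).
  nra.
Qed.

(** The product is |P(0)| / a. Passing from 2 a / 5 to 0 costs at most 2 a / 5 times the bound on
    |P'| there, and 1/5 - (2/5)(17/50) = 8/125 > 1/16. *)
Lemma prod_zeros_ge : a / 16 <= rprod (fun z => Cmod z) zs.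
Proof.
  pose proof N_pos as HN. pose proof prod_dist_ge1 as HA. pose proof exp_decay_small as Hs.
  pose proof value_at_two_fifths as H1.
  set (e := exp (- (N * a ^ 2 / 16))) in *.
  assert (H0 : Cmod (croots (RtoC a :: zs) 0%R) = a * rprod (fun z => Cmod z) zs).
  { rewrite Cmod_croots_cons by lra. rewrite Rminus_0_r. f_equal. apply rprod_ext.
    intros z _. rewrite <- (Cmod_opp z). f_equal. ring. }
  assert (H2 : Cmod (croots (RtoC a :: zs) (2 * a / 5)%R - croots (RtoC a :: zs) 0%R)%C <=
    (N + 1) * A * e * (2 * a / 5) - (N + 1) * A * e * 0).
  { apply (cderive_bound (fun t : R => croots (RtoC a :: zs) t)
      (fun t : R => croots_deriv (RtoC a :: zs) t)
      (fun t => (N + 1) * A * e * t) (fun _ => (N + 1) * A * e)).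
    - lra.
    - intros t _. apply cderive_croots_R.
    - intros t _. auto_derive; [easy|ring].
    - intros t Ht. now apply Cmod_deriv_near_0. }
  pose proof (Cmod_minus_ge (croots (RtoC a :: zs) (2 * a / 5)%R)
    (croots (RtoC a :: zs) (2 * a / 5)%R - croots (RtoC a :: zs) 0%R)%C) as H3.
  match type of H3 with _ <= Cmod (?x - (?x - ?y))%C =>
    replace (x - (x - y))%C with y in H3 by ring end.
  rewrite H0 in H3.
  apply (Rmult_le_reg_l a); [lra|].
  assert (Hm : (N + 1) * A / N * (/ 5 - 2 / 5 * (N * a * e)) <= a * rprod (fun z => Cmod z) zs).
  { replace ((N + 1) * A / N * (/ 5 - 2 / 5 * (N * a * e))) with
      (/ 5 * ((N + 1) * A / N) - (N + 1) * A * e * (2 * a / 5)) by (field; lra).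
    lra. }
  assert (H4 : 1 <= (N + 1) * A / N) by (apply (Rle_div_r 1 _ N); nra).
  nra.
Qed.

End Counterexample.

(** * Pseudo-hyperbolic distances from c to the zeros *)

(* The pseudo-hyperbolic disk of center [c] and radius [r] is the Euclidean disk of center
   [c - c r e] and radius [e], where [e = r (1 - c^2) / (1 - c^2 r^2)]. *)
Lemma pseudo_hyperbolic_disk_closer (c d r : R) (z w : C) :
  0 < c -> 0 < d -> c + d < 1 -> 9 * d <= c -> 0 < r <= / 40 ->
  2 * r * (1 - c ^ 2) = c * d ->
  Cmod (c - z)%C < r * Cmod (1 - c * z)%C -> critical_region (c + d) w ->
  Cmod (z - w)%C < Cmod (RtoC (c + d) - w)%C.
Proof.
  intros Hc Hd Hcd1 Hdc Hr Hrc Hz Hw.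
  assert (Ha : 0 < c + d < 1) by lra.
  destruct (critical_region_dist (c + d) Ha w Hw) as [Hu _].
  destruct Hw as [Hw1 _].
  assert (Hcr : 0 < c * r <= / 40).
  { split; [apply Rmult_lt_0_compat; lra|].
    replace (/ 40) with (1 * / 40) by ring. apply Rmult_le_compat; lra. }
  assert (Hcr2 : 0 <= c ^ 2 * r ^ 2 <= / 40).
  { replace (c ^ 2 * r ^ 2) with ((c * r) * (c * r)) by ring. nra. }
  assert (HK : 0 < 1 - c ^ 2 * r ^ 2) by lra.
  set (e := r * (1 - c ^ 2) / (1 - c ^ 2 * r ^ 2)).
  assert (He : e * (1 - c ^ 2 * r ^ 2) = r * (1 - c ^ 2)) by (unfold e; field; lra).
  assert (He0 : 0 < e).
  { unfold e. apply Rdiv_lt_0_compat; [|easy]. nra. }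
  (* By [Hrc], e (1 - c^2 r^2) = c d / 2, and c r is small. *)
  assert (Hed : e <= c * d).
  { assert (0 <= e * (/ 40 - c ^ 2 * r ^ 2)) by (apply Rmult_le_pos; lra). lra. }
  set (c0 := c - c * r * e). set (d0 := d + c * r * e).
  assert (Hin : Cmod (z - c0)%C < e).
  { apply Rsqr_incrst_0; [|apply Cmod_ge_0|lra].
    apply Rsqr_incrst_1 in Hz; [|apply Cmod_ge_0|].
    2: { apply Rmult_le_pos; [lra|apply Cmod_ge_0]. }
    unfold Rsqr in *.
    replace (r * Cmod (1 - c * z)%C * (r * Cmod (1 - c * z)%C)) with
      (r ^ 2 * (Cmod (1 - c * z)%C * Cmod (1 - c * z)%C)) in Hz by ring.
    rewrite !Cmod_sqr in Hz. rewrite Cmod_sqr. destruct z as [x y]. simpl in Hz |- *.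
    apply (Rmult_lt_reg_l (1 - c ^ 2 * r ^ 2)); [easy|].
    assert (E1 : (1 - c ^ 2 * r ^ 2) * c0 = c * (1 - r ^ 2)).
    { unfold c0. replace ((1 - c ^ 2 * r ^ 2) * (c - c * r * e)) with
        (c * (1 - c ^ 2 * r ^ 2) - c * r * (e * (1 - c ^ 2 * r ^ 2))) by ring.
      rewrite He. ring. }
    assert (E2 : (1 - c ^ 2 * r ^ 2) * (c0 * c0 - e * e) = c ^ 2 - r ^ 2).
    { apply (Rmult_eq_reg_l (1 - c ^ 2 * r ^ 2)); [|lra].
      replace ((1 - c ^ 2 * r ^ 2) * ((1 - c ^ 2 * r ^ 2) * (c0 * c0 - e * e))) with
        (((1 - c ^ 2 * r ^ 2) * c0) ^ 2 - (e * (1 - c ^ 2 * r ^ 2)) ^ 2) by ring.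
      rewrite E1, He. ring. }
    assert (E3 : (1 - c ^ 2 * r ^ 2) *
      ((x + - c0) * (x + - c0) + (y + - 0) * (y + - 0)) - (1 - c ^ 2 * r ^ 2) * (e * e) =
      (1 - c ^ 2 * r ^ 2) * (x * x + y * y) - 2 * x * ((1 - c ^ 2 * r ^ 2) * c0) +
      (1 - c ^ 2 * r ^ 2) * (c0 * c0 - e * e)) by ring.
    rewrite E1, E2 in E3. nra. }
  (* Since |w| <= 1, Re w is bounded above in terms of D = |c + d - w|, and the claim follows once a
     quadratic in D is nonnegative for D >= 1. [Hphi1] is its value at D = 1 divided by c + d, and
     [Hphi] is the rest. *)
  assert (Hcen : Cmod (c0 - w)%C <= Cmod (RtoC (c + d) - w)%C - e).
  { apply Cmod_le_iff; [nra|].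
    assert (Hu2 := Cmod_sqr (RtoC (c + d) - w)%C).
    set (D := Cmod (RtoC (c + d) - w)%C) in *.
    apply Rsqr_incr_1 in Hw1; [|apply Cmod_ge_0|lra]. unfold Rsqr in Hw1.
    rewrite Cmod_sqr in Hw1. destruct w as [w1 w2]. simpl in Hu2, Hw1 |- *.
    assert (Hu1 : D * D - 1 + (c + d) ^ 2 <= 2 * (c + d) * (c + d - w1)) by nra.
    assert (Hd0 : d0 = c + d - c0) by (unfold d0, c0; ring).
    assert (Hd0pos : d <= d0) by (unfold d0; nra).
    assert (Hphi1 : 0 <= (c + d) * d0 - d0 * d0 - 2 * e + e * e).
    { replace ((c + d) * d0 - d0 * d0 - 2 * e + e * e) with
        (c * d + c ^ 2 * r * e - c * r * e * d - c ^ 2 * r ^ 2 * e * e - 2 * e + e * e)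
        by (unfold d0; ring).
      rewrite <- Hrc. replace (2 * r * (1 - c ^ 2)) with (2 * (e * (1 - c ^ 2 * r ^ 2)))
        by (rewrite He; ring).
      replace (2 * (e * (1 - c ^ 2 * r ^ 2)) + c ^ 2 * r * e - c * r * e * d -
        c ^ 2 * r ^ 2 * e * e - 2 * e + e * e) with
        (e * (c * r * (c - 2 * (c * r) - d) + e * (1 - c ^ 2 * r ^ 2))) by ring.
      apply Rmult_le_pos; [lra|]. apply Rplus_le_le_0_compat.
      - apply Rmult_le_pos; [lra|]. nra.
      - apply Rmult_le_pos; lra. }
    assert (Hphi : 0 <= (D * D - 1) * d0 - 2 * (c + d) * e * (D - 1)).
    { replace ((D * D - 1) * d0 - 2 * (c + d) * e * (D - 1)) with
        ((D - 1) * ((D + 1) * d0 - 2 * (c + d) * e)) by ring.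
      apply Rmult_le_pos; [lra|].
      assert ((c + d) * e <= d) by nra. nra. }
    replace ((c0 + - w1) * (c0 + - w1) + (0 + - w2) * (0 + - w2)) with
      (D * D - 2 * d0 * (c + d - w1) + d0 * d0) by (rewrite Hu2, Hd0; ring).
    replace ((D - e) * (D - e)) with (D * D - 2 * D * e + e * e) by ring.
    apply (Rmult_le_reg_l (c + d)); [lra|].
    assert (d0 * (D * D - 1 + (c + d) ^ 2) <= d0 * (2 * (c + d) * (c + d - w1)))
      by (apply Rmult_le_compat_l; lra).
    nra. }
  pose proof (Cmod_triangle (z - c0) (c0 - w)) as H.
  replace (z - c0 + (c0 - w))%C with (z - w)%C in H by ring. lra.
Qed.

(* [k v = kappa ln ((c + v) / (1 + c v)) - ln v] vanishes at [r] and [1], and the sign of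
   its derivative is that of [kappa (1 - c^2) - (c / v + 1 + c^2 + c v)], whose second term
   decreases on [(0, 1)]; hence [k] cannot be positive in between. *)
Lemma ln_pseudo_hyperbolic_ratio (c r u : R) :
  0 < c < 1 -> 0 < r < 1 -> r <= u <= 1 ->
  ln r / ln ((c + r) / (1 + c * r)) * ln ((c + u) / (1 + c * u)) <= ln u.
Proof.
  intros Hc Hr Hu. set (kappa := ln r / ln ((c + r) / (1 + c * r))).
  set (k := fun v => kappa * (ln (c + v) - ln (1 + c * v)) - ln v).
  set (dk := fun v => kappa * (/ (c + v) - c / (1 + c * v)) - / v).
  assert (Hquot : forall v, 0 < v -> ln ((c + v) / (1 + c * v)) = ln (c + v) - ln (1 + c * v)).
  { intros v Hv. unfold Rdiv. rewrite ln_mult, ln_Rinv; try apply Rinv_0_lt_compat; nra. }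
  assert (Hrho : ln ((c + r) / (1 + c * r)) < 0).
  { rewrite <- ln_1. apply ln_increasing.
    - apply Rdiv_lt_0_compat; nra.
    - apply Rlt_div_l; nra. }
  assert (Hkr : k r = 0).
  { unfold k. rewrite <- Hquot by lra. unfold kappa. field. lra. }
  assert (Hk1 : k 1 = 0).
  { unfold k. rewrite ln_1, Rmult_1_r, (Rplus_comm c 1). ring. }
  assert (Hdk : forall v, 0 < v -> is_derive k v (dk v)).
  { intros v Hv. unfold k, dk. auto_derive; [repeat split; nra|]. field. repeat split; nra. }
  rewrite Hquot by lra. apply Rminus_le. fold (k u). apply Rnot_lt_le. intros Hpos.
  assert (Hru : r < u) by (destruct (proj1 Hu) as [?|E]; [easy|rewrite <- E in Hpos; lra]).
  assert (Hu1 : u < 1) by (destruct (proj2 Hu) as [?|E]; [easy|rewrite E in Hpos; lra]).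
  destruct (mean_value k dk r u Hru) as [x [Hx Ex]]; [intros; apply Hdk; lra|].
  destruct (mean_value k dk u 1 Hu1) as [y [Hy Ey]]; [intros; apply Hdk; lra|].
  assert (Hdx : 0 < dk x) by (rewrite Hkr in Ex; nra).
  assert (Hdy : dk y < 0) by (rewrite Hk1 in Ey; nra).
  assert (Hsign : forall v, 0 < v ->
    dk v * (v * (c + v) * (1 + c * v)) = kappa * (1 - c ^ 2) * v - (c + v) * (1 + c * v)).
  { intros v Hv. unfold dk. field. repeat split; nra. }
  assert (H1 : 0 < kappa * (1 - c ^ 2) * x - (c + x) * (1 + c * x)).
  { rewrite <- Hsign by lra. apply Rmult_lt_0_compat; [easy|].
    repeat apply Rmult_lt_0_compat; nra. }
  assert (H2 : kappa * (1 - c ^ 2) * y - (c + y) * (1 + c * y) < 0).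
  { rewrite <- Hsign by lra. apply Rmult_neg_pos; [easy|].
    repeat apply Rmult_lt_0_compat; nra. }
  assert (H3 : 0 < y * (kappa * (1 - c ^ 2) * x - (c + x) * (1 + c * x)))
    by (apply Rmult_lt_0_compat; lra).
  assert (H4 : 0 < x * - (kappa * (1 - c ^ 2) * y - (c + y) * (1 + c * y)))
    by (apply Rmult_lt_0_compat; lra).
  assert (H5 : 0 < c * ((y - x) * (1 - x * y))).
  { apply Rmult_lt_0_compat; [lra|]. apply Rmult_lt_0_compat; nra. }
  lra.
Qed.

Lemma Cmod_one_minus_ge (c : R) (z : C) :
  0 < c < 1 -> Cmod z <= 1 -> 0 < 1 - c <= Cmod (1 - c * z)%C.
Proof.
  intros Hc Hz. split; [lra|].
  pose proof (Cmod_minus_ge 1 (c * z)) as H.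
  rewrite Cmod_1, Cmod_mult, Cmod_R, Rabs_pos_eq in H by lra. nra.
Qed.

Definition pseudo_dist (c : R) (z : C) : R := Cmod (c - z)%C / Cmod (1 - c * z)%C.

(** From |1 - c z|^2 - |c - z|^2 = (1 - c^2) (1 - |z|^2). *)
Lemma pseudo_dist_le1 (c : R) (z : C) :
  0 < c < 1 -> Cmod z <= 1 -> pseudo_dist c z <= 1.
Proof.
  intros Hc Hz. destruct (Cmod_one_minus_ge c z Hc Hz). unfold pseudo_dist.
  apply (Rle_div_l _ 1); [lra|]. rewrite Rmult_1_l.
  apply Cmod_le_iff; [lra|]. rewrite Cmod_sqr.
  apply Rsqr_incr_1 in Hz; [|apply Cmod_ge_0|lra]. unfold Rsqr in Hz.
  rewrite Cmod_sqr in Hz. destruct z as [x y]. simpl in *.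
  assert (0 <= (1 - c * c) * (1 - (x * x + y * y))) by (apply Rmult_le_pos; nra). lra.
Qed.

(** The strong triangle inequality of the pseudo-hyperbolic metric for 0, c and z, with equality for
    real z >= c. *)
Lemma Cmod_le_pseudo_dist (c : R) (z : C) :
  0 < c < 1 -> Cmod z <= 1 ->
  Cmod z <= (c + pseudo_dist c z) / (1 + c * pseudo_dist c z).
Proof.
  intros Hc Hz. destruct (Cmod_one_minus_ge c z Hc Hz) as [Hc1 Hden].
  assert (Hp0 : 0 <= pseudo_dist c z).
  { unfold pseudo_dist. apply Rmult_le_pos; [apply Cmod_ge_0|].
    left. apply Rinv_0_lt_compat. lra. }
  apply Rle_div_r; [nra|].
  assert (H : (Cmod z - c) * Cmod (1 - c * z)%C <= Cmod (c - z)%C * (1 - c * Cmod z)).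
  { destruct (Rle_lt_dec (Cmod z) c) as [Hle|Hlt].
    - apply Rle_trans with 0.
      + assert (0 <= (c - Cmod z) * Cmod (1 - c * z)%C) by (apply Rmult_le_pos; lra). lra.
      + apply Rmult_le_pos; [apply Cmod_ge_0|nra].
    - apply Rsqr_incr_0_var.
      2: { apply Rmult_le_pos; [apply Cmod_ge_0|nra]. }
      unfold Rsqr.
      replace ((Cmod z - c) * Cmod (1 - c * z)%C * ((Cmod z - c) * Cmod (1 - c * z)%C)) with
        ((Cmod z - c) ^ 2 * (Cmod (1 - c * z)%C * Cmod (1 - c * z)%C)) by ring.
      replace (Cmod (c - z)%C * (1 - c * Cmod z) * (Cmod (c - z)%C * (1 - c * Cmod z))) with
        ((1 - c * Cmod z) ^ 2 * (Cmod (c - z)%C * Cmod (c - z)%C)) by ring.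
      rewrite (Cmod_sqr (1 - c * z)%C), (Cmod_sqr (c - z)%C).
      pose proof (Cmod_sqr z) as E. pose proof (Re_le_Cmod z) as Hre. unfold Re in Hre.
      set (p := Cmod z) in *. destruct z as [x y]. simpl in *.
      replace ((1 + - (c * x - 0 * y)) * (1 + - (c * x - 0 * y)) +
        (0 + - (c * y + 0 * x)) * (0 + - (c * y + 0 * x))) with
        (1 - 2 * c * x + c ^ 2 * (x * x + y * y)) by ring.
      replace ((c + - x) * (c + - x) + (0 + - y) * (0 + - y)) with
        (c ^ 2 - 2 * c * x + (x * x + y * y)) by ring.
      rewrite <- E.
      (* This is exactly the difference of the two squares being compared. *)
      assert (0 <= 2 * c * (p - x) * ((1 - c ^ 2) * (1 - p ^ 2))).
      { apply Rmult_le_pos; [nra|]. apply Rmult_le_pos; nra. }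
      nra. }
  assert (E : pseudo_dist c z * Cmod (1 - c * z)%C = Cmod (c - z)%C)
    by (unfold pseudo_dist; field; lra).
  rewrite <- E in H.
  assert (Cmod z - c <= pseudo_dist c z * (1 - c * Cmod z)).
  { apply (Rmult_le_reg_r (Cmod (1 - c * z)%C)); lra. }
  lra.
Qed.

Lemma rprod_neq0_factor (f : C -> R) (rs : list C) (r : C) :
  rprod f rs <> 0 -> In r rs -> f r <> 0.
Proof.
  induction rs as [|s rs IH]; simpl; [easy|].
  intros H [->|Hin] E.
  - apply H. rewrite E. ring.
  - apply (IH); trivial. intros E2. apply H. rewrite E2. ring.
Qed.

(** Termwise, kappa ln |z| is at most ln of the pseudo-hyperbolic distance, by [Cmod_le_pseudo_dist]
    and [ln_pseudo_hyperbolic_ratio]. Summing turns the bound m into r to the power [alpha] when m =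
    a / 16. *)
Lemma rprod_pseudo_dist_ge (c r m : R) (zs : list C) :
  0 < c < 1 -> 0 < r < 1 -> 0 < m ->
  (forall z, In z zs -> Cmod z <= 1) ->
  (forall z, In z zs -> r <= pseudo_dist c z) ->
  m <= rprod (fun z => Cmod z) zs ->
  Rpower r (ln m / ln ((c + r) / (1 + c * r))) <= rprod (pseudo_dist c) zs.
Proof.
  intros Hc Hr Hm Hz Hd Hprod.
  assert (Hnz : forall z, In z zs -> 0 < Cmod z).
  { intros z Hin.
    assert (Cmod z <> 0) by (apply (rprod_neq0_factor (fun z => Cmod z) zs); [lra|easy]).
    pose proof (Cmod_ge_0 z). lra. }
  assert (Hpos : forall z, In z zs -> 0 < pseudo_dist c z)
    by (intros z Hin; specialize (Hd z Hin); lra).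
  assert (Hrho : ln ((c + r) / (1 + c * r)) < 0).
  { rewrite <- ln_1. apply ln_increasing.
    - apply Rdiv_lt_0_compat; nra.
    - apply Rlt_div_l; nra. }
  assert (Hlr : ln r < 0) by (rewrite <- ln_1; apply ln_increasing; lra).
  set (kappa := ln r / ln ((c + r) / (1 + c * r))).
  assert (Hk : 0 < kappa).
  { unfold kappa. replace (ln r / ln ((c + r) / (1 + c * r))) with
      (- ln r / - ln ((c + r) / (1 + c * r))) by (field; lra).
    apply Rdiv_lt_0_compat; lra. }
  rewrite <- (exp_ln (rprod (pseudo_dist c) zs)) by now apply rprod_pos.
  unfold Rpower. apply exp_le_compat.
  rewrite ln_rprod by easy.
  apply Rle_trans with (kappa * rsum (fun z => ln (Cmod z)) zs).
  - rewrite <- ln_rprod by easy.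
    replace (ln m / ln ((c + r) / (1 + c * r)) * ln r) with (kappa * ln m)
      by (unfold kappa; field; lra).
    apply Rmult_le_compat_l; [lra|]. now apply ln_le.
  - rewrite <- rsum_scal. apply rsum_le. intros z Hin.
    apply Rle_trans with (kappa * ln ((c + pseudo_dist c z) / (1 + c * pseudo_dist c z))).
    + apply Rmult_le_compat_l; [lra|]. apply ln_le; [auto|].
      apply Cmod_le_pseudo_dist; auto.
    + apply ln_pseudo_hyperbolic_ratio; trivial. split; [auto|]. apply pseudo_dist_le1; auto.
Qed.

(** * The reflected product *)

(** As |1 - c s| = c |1/c - s|, both products are values at 1/c, outside the unit disk, where
    [Cmod_croots_deriv_le] compares them. The two lengths differ by one, which leaves the factor c
    that turns 1/c - 1 into 1 - c. *)
Lemma rprod_reflected_ge (c : R) (rs ws : list C) :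
  0 < c < 1 -> rs <> nil -> (forall r, In r rs -> Cmod r <= 1) ->
  S (length ws) = length rs ->
  (forall x, croots_deriv rs x = RtoC (INR (length rs)) * croots ws x)%C ->
  (1 - c) * rprod (fun w => Cmod (1 - c * w)%C) ws <= rprod (fun r => Cmod (1 - c * r)%C) rs.
Proof.
  intros Hc Hne Hr Hlen Hd.
  assert (Hscale : forall ss : list C,
    rprod (fun s => Cmod (1 - c * s)%C) ss = c ^ length ss * Cmod (croots ss (/ c)%R)).
  { intros ss. rewrite Cmod_croots, <- rprod_const, <- rprod_mult. apply rprod_ext.
    intros s _. rewrite <- (Rabs_pos_eq c), <- Cmod_R, <- Cmod_mult by lra.
    rewrite Cmod_R, Rabs_pos_eq by lra. f_equal.
    rewrite RtoC_inv by lra. field. intros E. apply RtoC_inj in E. lra. }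
  rewrite !Hscale, <- Hlen. simpl pow.
  assert (H1c : 1 < / c) by (rewrite <- Rinv_1 at 1; apply Rinv_lt_contravar; lra).
  assert (Hx : 1 < Cmod (/ c)%R) by (rewrite Cmod_R, Rabs_pos_eq; lra).
  pose proof (Cmod_croots_deriv_le rs (/ c)%R Hx Hr) as H.
  rewrite Hd, Cmod_mult, !Cmod_R, !Rabs_pos_eq in H by (lra || apply pos_INR).
  assert (Hn : 0 < INR (length rs)) by (destruct rs; [easy|]; apply lt_0_INR; simpl; lia).
  assert (H2 : (1 - c) * Cmod (croots ws (/ c)%R) <= c * Cmod (croots rs (/ c)%R)).
  { apply (Rmult_le_reg_l (INR (length rs))); [easy|].
    replace (INR (length rs) * ((1 - c) * Cmod (croots ws (/ c)%R))) with
      ((1 - c) * (INR (length rs) * Cmod (croots ws (/ c)%R))) by ring.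
    eapply Rle_trans; [apply Rmult_le_compat_l; [lra|exact H]|].
    right. field. split; lra. }
  pose proof (pow_lt c (length ws) (proj1 Hc)). nra.
Qed.

(** * Lower bound for the product of the |1 - c w| over the lune *)

Lemma ln_concave (x y l : R) :
  0 < x -> 0 < y -> 0 <= l <= 1 -> l * ln x + (1 - l) * ln y <= ln (l * x + (1 - l) * y).
Proof.
  intros Hx Hy Hl. set (m := l * x + (1 - l) * y).
  assert (Hm : 0 < m).
  { unfold m. destruct (Rle_lt_dec l (1 / 2)).
    - apply Rplus_le_lt_0_compat; [apply Rmult_le_pos; lra|apply Rmult_lt_0_compat; lra].
    - apply Rplus_lt_le_0_compat; [apply Rmult_lt_0_compat; lra|apply Rmult_le_pos; lra]. }
  (* The tangent line of ln at m. *)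
  assert (H : forall t, 0 < t -> ln t <= ln m + (t / m - 1)).
  { intros t Ht. assert (Htm : 0 < t / m) by now apply Rdiv_lt_0_compat.
    pose proof (exp_ineq1_le (ln (t / m))) as He. rewrite exp_ln in He by easy.
    unfold Rdiv at 1 in He. rewrite ln_mult, ln_Rinv in He; trivial; [lra|].
    now apply Rinv_0_lt_compat. }
  pose proof (Rmult_le_compat_l l _ _ (proj1 Hl) (H x Hx)).
  pose proof (Rmult_le_compat_l (1 - l) _ _ ltac:(lra) (H y Hy)).
  assert (l * (x / m - 1) + (1 - l) * (y / m - 1) = 0).
  { replace (l * (x / m - 1) + (1 - l) * (y / m - 1)) with ((l * x + (1 - l) * y) / m - 1)
      by (field; lra). fold m. field. lra. }
  lra.
Qed.

Lemma ln_sqrt (x : R) : 0 < x -> ln (sqrt x) = ln x / 2.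
Proof.
  intros Hx. assert (Hs : 0 < sqrt x) by now apply sqrt_lt_R0.
  rewrite <- (sqrt_sqrt x) at 2 by lra. rewrite ln_mult by easy. field.
Qed.

(** The line of slope -m in Re w starts at the value for Re w = a / 2; the two hypotheses on m keep
    it below the values at a - 1 and -1, hence below the chords. *)
Lemma ln_one_minus_lower_bound (a c m : R) (w : C) :
  0 < a < 1 -> 0 < c < a -> 0 <= m ->
  m * (1 - a / 2) <= ln (1 + c - a * c) - ln (sqrt (1 + c ^ 2 - a * c)) ->
  m * (1 + a / 2) <= ln (1 + c) - ln (sqrt (1 + c ^ 2 - a * c)) ->
  critical_region a w ->
  ln (sqrt (1 + c ^ 2 - a * c)) + m * (a / 2 - fst w) <= ln (Cmod (1 - c * w)%C).
Proof.
  intros Ha Hc Hm HA HC Hw.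
  pose proof (critical_region_Re a Ha w Hw) as Hre.
  destruct Hw as [Hw1 Hw2].
  destruct (Cmod_one_minus_ge c w ltac:(lra) Hw1) as [_ Hden].
  assert (Hs : 0 < 1 + c ^ 2 - a * c) by nra.
  assert (Hs' : 0 < 1 + c - a * c) by nra.
  pose proof (Re_le_Cmod (- w)%C) as Hx. rewrite Cmod_opp in Hx. simpl in Hx.
  assert (E : ln (Cmod (1 - c * w)%C) = ln (Cmod (1 - c * w)%C * Cmod (1 - c * w)%C) / 2)
    by (rewrite ln_mult by lra; field).
  assert (Hw3 : 1 < Cmod (a - w)%C * Cmod (a - w)%C) by nra.
  rewrite Cmod_sqr in Hw3.
  set (B := ln (sqrt (1 + c ^ 2 - a * c))) in *.
  destruct (Rle_lt_dec (a - 1) (fst w)) as [Hcase|Hcase].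
  (* Here |w - a| > 1 bounds |1 - c w|^2 below by an affine function of Re w, equal to 1 + c^2 - a c
     at a / 2 and to (1 + c - a c)^2 at a - 1. Left of a - 1, the bound |1 - c w| >= 1 - c Re w
     suffices. *)
  - set (l := (a / 2 - fst w) / (1 - a / 2)).
    assert (El : l * (1 - a / 2) = a / 2 - fst w) by (unfold l; field; lra).
    assert (Hl : 0 <= l <= 1) by (split; nra).
    assert (H : l * ln ((1 + c - a * c) ^ 2) + (1 - l) * ln (1 + c ^ 2 - a * c) <=
      ln (Cmod (1 - c * w)%C * Cmod (1 - c * w)%C)).
    { eapply Rle_trans; [apply ln_concave; nra|].
      apply ln_le.
      - replace (l * (1 + c - a * c) ^ 2 + (1 - l) * (1 + c ^ 2 - a * c)) with
          (1 + c ^ 2 - a * c + (l * (1 - a / 2)) * (2 * c * (1 - a * c))) by field.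
        rewrite El. assert (0 <= (a / 2 - fst w) * (2 * c * (1 - a * c))).
        { apply Rmult_le_pos; [lra|]. apply Rmult_le_pos; nra. }
        lra.
      - replace (l * (1 + c - a * c) ^ 2 + (1 - l) * (1 + c ^ 2 - a * c)) with
          (1 + c ^ 2 - a * c + (l * (1 - a / 2)) * (2 * c * (1 - a * c))) by field.
        rewrite El, Cmod_sqr. destruct w as [x y]. simpl in *. nra. }
    assert (E2 : ln ((1 + c - a * c) ^ 2) = 2 * ln (1 + c - a * c)).
    { replace ((1 + c - a * c) ^ 2) with ((1 + c - a * c) * (1 + c - a * c)) by ring.
      rewrite ln_mult by easy. ring. }
    assert (EB : ln (1 + c ^ 2 - a * c) = 2 * B) by (unfold B; rewrite ln_sqrt by easy; field).
    rewrite E2, EB in H. rewrite E, <- El.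
    pose proof (Rmult_le_compat_l l _ _ (proj1 Hl) HA). lra.
  - set (l := (a - 1 - fst w) / a).
    assert (El : l * a = a - 1 - fst w) by (unfold l; field; lra).
    assert (Hl : 0 <= l <= 1) by (split; nra).
    assert (H : l * ln (1 + c) + (1 - l) * ln (1 + c - a * c) <= ln (Cmod (1 - c * w)%C)).
    { eapply Rle_trans; [apply ln_concave; lra|].
      replace (l * (1 + c) + (1 - l) * (1 + c - a * c)) with (1 + c - a * c + c * (l * a)) by ring.
      rewrite El. apply ln_le; [nra|].
      pose proof (Re_le_Cmod (1 - c * w)%C) as H. destruct w as [x y]. simpl in *. lra. }
    pose proof (Rmult_le_compat_l l _ _ (proj1 Hl) HC).
    pose proof (Rmult_le_compat_l (1 - l) _ _ ltac:(lra) HA).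
    replace (a / 2 - fst w) with (l * (1 + a / 2) + (1 - l) * (1 - a / 2)) by lra.
    lra.
Qed.

Lemma cc_bounds (a : R) :
  0 < a < 1 -> 0 < cc a < a /\ a - cc a = a * (1 - a) / 10 /\ 9 * (a - cc a) <= cc a.
Proof. intros Ha. unfold cc, gam. repeat split; nra. Qed.

(** As c < a, r is below a^2 / (20 (1 + a)), which is less than 1 / 40. *)
Lemma rr_bounds (a : R) :
  0 < a < 1 ->
  0 < rr a <= / 40 /\ 2 * rr a * (1 - cc a ^ 2) = cc a * (a - cc a).
Proof.
  intros Ha. destruct (cc_bounds a Ha) as [Hc [Hd _]].
  assert (H1 : 0 < 1 - cc a ^ 2) by nra.
  assert (E : 2 * rr a * (1 - cc a ^ 2) = cc a * (a - cc a)) by (unfold rr; field; lra).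
  repeat split; trivial.
  - unfold rr. apply Rdiv_lt_0_compat; [apply Rmult_lt_0_compat|]; lra.
  - apply (Rmult_le_reg_r (2 * (1 - cc a ^ 2))); [lra|].
    replace (rr a * (2 * (1 - cc a ^ 2))) with (cc a * (a - cc a)) by (rewrite <- E; ring).
    rewrite Hd.
    assert (cc a * (a * (1 - a) / 10) <= a * (a * (1 - a) / 10))
      by (apply Rmult_le_compat_r; nra).
    assert (0 <= (1 - a) * (1 + a - 2 * a ^ 2)) by (apply Rmult_le_pos; nra).
    nra.
Qed.

(** [pp] and [qq] are the weights that place a / 4 between a / 2 and a - 1, respectively -1. So [Kp]
    is the exponential of the lower of two lines at a / 4, and its slope, the smaller one, satisfies
    both conditions. *)
Lemma Kp_slope (a : R) :
  0 < a < 1 ->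
  exists m, 0 <= m /\
    m * (1 - a / 2) <= ln (1 + cc a - a * cc a) - ln (sqrt (1 + cc a ^ 2 - a * cc a)) /\
    m * (1 + a / 2) <= ln (1 + cc a) - ln (sqrt (1 + cc a ^ 2 - a * cc a)) /\
    Kp a = exp (ln (sqrt (1 + cc a ^ 2 - a * cc a)) + m * (a / 4)).
Proof.
  intros Ha. destruct (cc_bounds a Ha) as [Hc _]. unfold Kp. set (c := cc a) in *.
  assert (Hs : 0 < 1 + c ^ 2 - a * c) by nra.
  assert (HAB : ln (sqrt (1 + c ^ 2 - a * c)) <= ln (1 + c - a * c)).
  { apply ln_le; [now apply sqrt_lt_R0|].
    rewrite <- (sqrt_Rsqr (1 + c - a * c)) by nra. apply sqrt_le_1_alt. unfold Rsqr.
    assert (0 <= c * ((2 - a) * (1 - c * a))).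
    { apply Rmult_le_pos; [lra|]. apply Rmult_le_pos; nra. }
    nra. }
  assert (HAC : ln (1 + c - a * c) <= ln (1 + c)) by (apply ln_le; nra).
  set (A := ln (1 + c - a * c)) in *. set (C1 := ln (1 + c)) in *.
  set (B := ln (sqrt (1 + c ^ 2 - a * c))) in *.
  set (m1 := (A - B) / (1 - a / 2)). set (m2 := (C1 - B) / (1 + a / 2)).
  assert (Hm1 : m1 * (1 - a / 2) = A - B) by (unfold m1; field; lra).
  assert (Hm2 : m2 * (1 + a / 2) = C1 - B) by (unfold m2; field; lra).
  assert (E1 : Rpower (1 + c - a * c) (pp a) *
    Rpower (sqrt (1 + c ^ 2 - a * c)) (1 - pp a) = exp (B + m1 * (a / 4))).
  { unfold Rpower. rewrite <- exp_plus. f_equal. fold A B. unfold pp, m1. field. lra. }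
  assert (E2 : Rpower (1 + c) (qq a) *
    Rpower (sqrt (1 + c ^ 2 - a * c)) (1 - qq a) = exp (B + m2 * (a / 4))).
  { unfold Rpower. rewrite <- exp_plus. f_equal. fold C1 B. unfold qq, m2. field. lra. }
  rewrite E1, E2.
  assert (H1 : 0 <= m1) by (apply Rmult_le_pos; [lra|left; apply Rinv_0_lt_compat; lra]).
  assert (H2 : 0 <= m2) by (apply Rmult_le_pos; [lra|left; apply Rinv_0_lt_compat; lra]).
  destruct (Rle_lt_dec m1 m2) as [Hle|Hlt].
  - exists m1. repeat split; [easy|lra|nra|].
    apply Rmin_left, exp_le_compat. nra.
  - exists m2. repeat split; [easy|nra|lra|].
    apply Rmin_right, exp_le_compat. nra.
Qed.

Lemma rprod_one_minus_critical_ge (a : R) (ws : list C) :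
  0 < a < 1 -> (forall w, In w ws -> critical_region a w) ->
  rsum fst ws <= INR (length ws) * (a / 4) ->
  Kp a ^ length ws <= rprod (fun w => Cmod (1 - cc a * w)%C) ws.
Proof.
  intros Ha Hws Hmean.
  destruct (cc_bounds a Ha) as [Hc _].
  destruct (Kp_slope a Ha) as [m [Hm [HA [HC EK]]]].
  set (B := ln (sqrt (1 + cc a ^ 2 - a * cc a))) in *.
  assert (Hpos : forall w, In w ws -> 0 < Cmod (1 - cc a * w)%C).
  { intros w Hin. destruct (Cmod_one_minus_ge (cc a) w ltac:(lra) (proj1 (Hws w Hin))). lra. }
  rewrite <- (exp_ln (rprod _ ws)) by now apply rprod_pos.
  rewrite EK, <- Rpower_pow by apply exp_pos. unfold Rpower. rewrite ln_exp.
  apply exp_le_compat. rewrite ln_rprod by easy.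
  apply Rle_trans with (rsum (fun w => (B + m * (a / 2)) + (- m) * fst w) ws).
  - rewrite rsum_affine. nra.
  - apply rsum_le. intros w Hin.
    pose proof (ln_one_minus_lower_bound a (cc a) m w Ha Hc Hm HA HC (Hws w Hin)) as H.
    fold B in H. lra.
Qed.

(** * Assembly of the lower bound *)

Lemma sendov_lower_bound (a : R) (zs : list C) :
  0 < a < 1 -> (forall z, In z zs -> Cmod z <= 1) ->
  (forall w, croots_deriv (RtoC a :: zs) w = 0%C -> 1 < Cmod (w - a)%C) ->
  degree_condition a (S (length zs)) ->
  (1 - cc a) * (a - cc a) / (1 - a * cc a) * Rpower (rr a) (alpha a) * Kp a ^ length zs <=
    Cmod (croots (RtoC a :: zs) (cc a)).
Proof.
  intros Ha Hzs Hcrit Hdeg.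
  destruct (cc_bounds a Ha) as [Hc [_ H9]]. destruct (rr_bounds a Ha) as [Hr Er].
  assert (Hrs : forall r, In r (RtoC a :: zs) -> Cmod r <= 1).
  { intros r [<-|Hin]; [rewrite Cmod_R, Rabs_pos_eq; lra|auto]. }
  destruct (Factorization.croots_deriv_factor (RtoC a :: zs)) as [ws [Hlen Hder Hsum]]; [easy|].
  simpl length in Hlen, Hder, Hsum. injection Hlen as Hlen.
  assert (Hws : forall w, In w ws -> critical_region a w).
  { intros w Hin.
    assert (H0 : croots_deriv (RtoC a :: zs) w = 0%C).
    { rewrite Hder, croots_eq0 by easy. ring. }
    split.
    - apply (critical_point_in_unit_disk (RtoC a :: zs)); easy.
    - rewrite Cmod_minus_sym. now apply Hcrit. }
  assert (HsumR : INR (length ws) * (a + rsum fst zs) = INR (S (length zs)) * rsum fst ws).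
  { apply (f_equal Re) in Hsum.
    assert (Hfst : forall ss, Re (csum (fun z => z) ss) = rsum fst ss)
      by (intros; rewrite Re_csum; reflexivity).
    assert (Hscal : forall (x : R) (z : C), Re (x * z)%C = x * Re z)
      by (intros; unfold Re; simpl; ring).
    rewrite !Hscal, !Hfst in Hsum. exact Hsum. }
  pose proof (mean_critical_points_le a zs ws Ha Hzs Hws Hlen Hder HsumR Hdeg) as Hmean.
  pose proof (prod_zeros_ge a zs ws Ha Hzs Hws Hlen Hder HsumR Hdeg) as Hprod.
  rewrite <- Hlen in Hmean.
  pose proof (rprod_one_minus_critical_ge a ws Ha Hws Hmean) as HK. rewrite Hlen in HK.
  assert (Hne : ws <> nil) by exact (ws_not_nil a zs ws Ha Hlen Hdeg).
  (* A zero z inside the disk would be closer than a to every critical point, and P(z) = P(a) = 0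
     would contradict [bisector]. *)
  assert (Hsep : forall z, In z zs -> rr a <= pseudo_dist (cc a) z).
  { intros z Hin. destruct (Cmod_one_minus_ge (cc a) z ltac:(lra) (Hzs z Hin)) as [Hc1 Hden].
    unfold pseudo_dist. apply (Rle_div_r (rr a)); [lra|].
    apply Rnot_lt_le. intros Hlt.
    apply (bisector (RtoC a :: zs) ws (INR (S (length zs))) a z Hne); [| exact Hder | |].
    - intros E. apply RtoC_inj in E. apply (not_0_INR (S (length zs))); easy.
    - intros w Hw.
      pose proof (pseudo_hyperbolic_disk_closer (cc a) (a - cc a) (rr a) z w) as H.
      replace (cc a + (a - cc a)) with a in H by ring. apply H; trivial; try lra. auto.
    - rewrite !croots_eq0; [reflexivity|now left|now right]. }
  pose proof (rprod_pseudo_dist_ge (cc a) (rr a) (a / 16) zs ltac:(lra) ltac:(lra) ltac:(lra)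
    Hzs Hsep Hprod) as Hpd.
  pose proof (rprod_reflected_ge (cc a) (RtoC a :: zs) ws ltac:(lra) ltac:(easy) Hrs
    ltac:(simpl; now rewrite Hlen) Hder) as Hrefl.
  (* The zero a contributes the factor 1 - a c, which becomes the denominator of the bound. *)
  assert (Hfac : rprod (fun r => Cmod (1 - cc a * r)%C) (RtoC a :: zs) =
    (1 - a * cc a) * rprod (fun z => Cmod (1 - cc a * z)%C) zs).
  { simpl. f_equal. rewrite <- RtoC_mult, <- RtoC_minus, Cmod_R, Rabs_pos_eq; nra. }
  rewrite Hfac in Hrefl.
  rewrite Cmod_croots_cons by lra.
  assert (Hsplit : rprod (fun z => Cmod (cc a - z)%C) zs =
    rprod (pseudo_dist (cc a)) zs * rprod (fun z => Cmod (1 - cc a * z)%C) zs).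
  { rewrite <- rprod_mult. apply rprod_ext. intros z Hin.
    destruct (Cmod_one_minus_ge (cc a) z ltac:(lra) (Hzs z Hin)).
    unfold pseudo_dist. field. lra. }
  rewrite Hsplit. fold (alpha a) in Hpd.
  set (U := rprod (pseudo_dist (cc a)) zs) in *.
  set (V := rprod (fun z => Cmod (1 - cc a * z)%C) zs) in *.
  assert (H1 : 0 < 1 - a * cc a) by nra.
  assert (HV : (1 - cc a) / (1 - a * cc a) * Kp a ^ length zs <= V).
  { replace ((1 - cc a) / (1 - a * cc a) * Kp a ^ length zs) with
      ((1 - cc a) * Kp a ^ length zs / (1 - a * cc a)) by (field; lra).
    apply (Rle_div_l _ V); [lra|].
    apply Rle_trans with ((1 - cc a) * rprod (fun w => Cmod (1 - cc a * w)%C) ws); [|lra].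
    apply Rmult_le_compat_l; lra. }
  assert (HK0 : 0 <= Kp a ^ length zs).
  { apply pow_le. destruct (Kp_slope a Ha) as [m [_ [_ [_ ->]]]]. left. apply exp_pos. }
  replace ((1 - cc a) * (a - cc a) / (1 - a * cc a) * Rpower (rr a) (alpha a) *
    Kp a ^ length zs) with ((a - cc a) * (Rpower (rr a) (alpha a) *
    ((1 - cc a) / (1 - a * cc a) * Kp a ^ length zs))) by (field; lra).
  apply Rmult_le_compat_l; [lra|].
  apply Rmult_le_compat; trivial.
  - left. apply exp_pos.
  - apply Rmult_le_pos; [|easy]. left. apply Rdiv_lt_0_compat; lra.
Qed.
End Sendov.

Theorem mainTheorem11 (a : R) (n : nat) (zs : list Cx) :
  0 < a < 1 ->
  (length zs + 1)%nat = n ->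
  (forall z, In z zs -> Cmod z <= 1) ->
  contradicts_sendov a zs ->
  INR n >= N1 a ->
  Cmod (peval (sendovP a zs) (RtoC (cc a))) >=
    (1 - cc a) * (a - cc a) / (1 - a * cc a) * Rpower (rr a) (alpha a) * Kp a ^ (n - 1).
Proof.
  intros Ha Hn Hzs Hcontra HN.
  replace (n - 1)%nat with (length zs) by lia.
  assert (Hdeg : Sendov.degree_condition a (S (length zs))).
  { apply Sendov.degree_condition_of_N1; [easy|]. now replace (S (length zs)) with n by lia. }
  assert (Hcrit : forall w, RootLists.croots_deriv (RtoC a :: zs) w = C0 ->
    1 < Cmod (Csub w (RtoC a))).
  { intros w Hw. apply Hcontra.
    etransitivity; [exact (RootBounds.ceval_pderiv_poly_of_roots (RtoC a :: zs) w)|exact Hw]. }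
  apply Rle_ge.
  replace (peval (sendovP a zs) (RtoC (cc a))) with
    (RootLists.croots (RtoC a :: zs) (RtoC (cc a)))
    by (symmetry; exact (RootBounds.ceval_poly_of_roots (RtoC a :: zs) (RtoC (cc a)))).
  exact (Sendov.sendov_lower_bound a zs Ha Hzs Hcrit Hdeg).
Qed.
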